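(* For any $\epsilon>0$, there is an algorithm that, for any instance of Euclidean Non-Uniform $k$-Center with $n$ points to cover in $\mathbb R^d$, computes a $(1+\epsilon)$-approximate solution in time $2^{O((k\log k)/\epsilon)}\, d\, n$.
   Context: Euclidean Non-Uniform $k$-Center: given a set $\mathcal C$ of $n$ points in $\mathbb R^d$ (with candidate centers $\mathcal F=\mathbb R^d$ and Euclidean distance), an integer $k>0$, $t\le k$ distinct integers (radii) $r_1>r_2>\dots>r_t>0$ and non-negative integers $k_1,\dots,k_t$ with $\sum_{i=1}^t k_i=k$, find a number (dilation) $\alpha$ and, for each $1\le i\le t$, $k_i$ balls with centers in $\mathbb R^d$ and radius $\alpha r_i$, such that their union contains $\mathcal C$ and $\alpha$ is minimized. A $(1+\epsilon)$-approximate solution is a feasible choice of balls whose dilation is at most $(1+\epsilon)$ times the optimal dilation. *)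

(* Defs.v *)
(* MathComp / MathComp-Analysis. *)
From mathcomp Require Import all_boot all_order all_algebra.
From mathcomp Require Import all_classical all_reals all_analysis.

Set Implicit Arguments.
Unset Strict Implicit.
Unset Printing Implicit Defensive.

Import Order.TTheory GRing.Theory Num.Theory.

Local Open Scope classical_set_scope.
Local Open Scope ring_scope.

(** * Euclidean Non-Uniform k-Center *)

(* The norm that the library puts on row vectors is the sup norm. *)
Definition eucl_dist (R : realType) (d : nat) (x y : 'rV[R]_d) : R :=
  Num.sqrt (\sum_(j < d) (x 0 j - y 0 j) ^+ 2).

Record nukc (R : realType) := Nukc {
  npts : nat;
  ndim : nat;
  ntypes : nat;
  pts : 'I_npts -> 'rV[R]_ndim;
  brad : 'I_ntypes -> nat;
  mlt : 'I_ntypes -> nat;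
  npts_gt0 : (0 < npts)%N;
  ndim_gt0 : (0 < ndim)%N;
  pts_inj : injective pts;
  brad_gt0 : forall i, (0 < brad i)%N;
  brad_decr : forall i j : 'I_ntypes, (i < j)%N -> (brad j < brad i)%N;
  mlt_sum_gt0 : (0 < \sum_i mlt i)%N;
  ntypes_le : (ntypes <= \sum_i mlt i)%N
}.

Definition nballs (R : realType) (I : nukc R) : nat :=
  (\sum_(i < ntypes I) mlt i)%N.

(* A choice of [mlt i] centers for every radius [brad i]. *)
Definition centers (R : realType) (I : nukc R) : Type :=
  forall i : 'I_(ntypes I), 'I_(mlt i) -> 'rV[R]_(ndim I).

Definition feasible (R : realType) (I : nukc R) (alpha : R) (c : centers I) :
    Prop :=
  0 <= alpha /\
  forall p : 'I_(npts I), exists (i : 'I_(ntypes I)) (j : 'I_(mlt i)),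
    eucl_dist (pts p) (c i j) <= alpha * (brad i)%:R.

Definition opt_dilation (R : realType) (I : nukc R) : R :=
  inf [set alpha | exists c : centers I, feasible alpha c].

Definition approx_solution (R : realType) (eps : R) (I : nukc R)
    (alpha : R) (c : centers I) : Prop :=
  feasible alpha c /\ alpha <= (1 + eps) * opt_dilation I.

(** * Real RAM

   Programs of a unit-cost random access machine with an integer memory
   (storing natural numbers) and a separate memory storing exact reals.  Each
   memory is split into banks.  The bank number in an access is a literal of
   the program, so a program uses finitely many banks, which interleaving
   would merge into one at the price of a constant factor; the cell number is
   computed, so addressing is indirect.  The only literals are natural
   numbers, and no operation turns a real into an integer (no floor): reals
   influence control only through comparisons. *)

Inductive iexp : Type :=
  | INat of nat
  | IGet of nat & iexp
  | IAdd of iexp & iexp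
  | ISub of iexp & iexp
  | IMul of iexp & iexp.

Inductive rexp : Type :=
  | ROfNat of iexp
  | RGet of nat & iexp
  | RAdd of rexp & rexp
  | RSub of rexp & rexp
  | RMul of rexp & rexp
  | RDiv of rexp & rexp
  | RSqrt of rexp.

Inductive bexp : Type :=
  | BILe of iexp & iexp
  | BRLe of rexp & rexp
  | BNot of bexp
  | BAnd of bexp & bexp.

Inductive cmd : Type :=
  | Skip
  | ISet of nat & iexp & iexp
  | RSet of nat & iexp & rexp
  | Seq of cmd & cmd
  | If of bexp & cmd & cmd
  | While of bexp & cmd.

Record state (R : realType) := State {
  imem : nat -> nat -> nat;
  rmem : nat -> nat -> R
}.

Definition upd (T : Type) (m : nat -> nat -> T) (a i : nat) (v : T) :
    nat -> nat -> T :=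
  fun a' i' => if (a' == a) && (i' == i) then v else m a' i'.

Fixpoint ieval (R : realType) (s : state R) (e : iexp) : nat :=
  match e with
  | INat n => n
  | IGet a e => imem s a (ieval s e)
  | IAdd e1 e2 => (ieval s e1 + ieval s e2)%N
  | ISub e1 e2 => (ieval s e1 - ieval s e2)%N
  | IMul e1 e2 => (ieval s e1 * ieval s e2)%N
  end.

(* Division by zero and the square root of a negative number return 0; a
   program can test for these cases beforehand. *)
Fixpoint reval (R : realType) (s : state R) (e : rexp) : R :=
  match e with
  | ROfNat e => (ieval s e)%:R
  | RGet a e => rmem s a (ieval s e)
  | RAdd e1 e2 => reval s e1 + reval s e2
  | RSub e1 e2 => reval s e1 - reval s e2
  | RMul e1 e2 => reval s e1 * reval s e2
  | RDiv e1 e2 => reval s e1 / reval s e2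
  | RSqrt e => Num.sqrt (reval s e)
  end.

Fixpoint beval (R : realType) (s : state R) (b : bexp) : bool :=
  match b with
  | BILe e1 e2 => (ieval s e1 <= ieval s e2)%N
  | BRLe e1 e2 => reval s e1 <= reval s e2
  | BNot b => ~~ beval s b
  | BAnd b1 b2 => beval s b1 && beval s b2
  end.

Fixpoint icost (e : iexp) : nat :=
  match e with
  | INat _ => 1%N
  | IGet _ e => (icost e).+1
  | IAdd e1 e2 | ISub e1 e2 | IMul e1 e2 => (icost e1 + icost e2)%N.+1
  end.

Fixpoint rcost (e : rexp) : nat :=
  match e with
  | ROfNat e | RGet _ e => (icost e).+1
  | RAdd e1 e2 | RSub e1 e2 | RMul e1 e2 | RDiv e1 e2 =>
      (rcost e1 + rcost e2)%N.+1
  | RSqrt e => (rcost e).+1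
  end.

Fixpoint bcost (b : bexp) : nat :=
  match b with
  | BILe e1 e2 => (icost e1 + icost e2)%N.+1
  | BRLe e1 e2 => (rcost e1 + rcost e2)%N.+1
  | BNot b => (bcost b).+1
  | BAnd b1 b2 => (bcost b1 + bcost b2)%N.+1
  end.

(* [exec c s T s']: started in state [s], the program [c] halts in state [s']
   after [T] steps.  This relation is deterministic. *)
Inductive exec (R : realType) : cmd -> state R -> nat -> state R -> Prop :=
  | ExecSkip s : exec Skip s 1%N s
  | ExecISet a e1 e2 s :
      exec (ISet a e1 e2) s (icost e1 + icost e2)%N.+1
        (State (upd (imem s) a (ieval s e1) (ieval s e2)) (rmem s))
  | ExecRSet a e1 e2 s :
      exec (RSet a e1 e2) s (icost e1 + rcost e2)%N.+1
        (State (imem s) (upd (rmem s) a (ieval s e1) (reval s e2)))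
  | ExecSeq c1 c2 s1 s2 s3 T1 T2 :
      exec c1 s1 T1 s2 -> exec c2 s2 T2 s3 ->
      exec (Seq c1 c2) s1 (T1 + T2)%N s3
  | ExecIf b c1 c2 s s' T :
      exec (if beval s b then c1 else c2) s T s' ->
      exec (If b c1 c2) s (bcost b + T)%N.+1 s'
  | ExecWhileFalse b c s :
      ~~ beval s b -> exec (While b c) s (bcost b).+1 s
  | ExecWhileTrue b c s1 s2 s3 T1 T2 :
      beval s1 b -> exec c s1 T1 s2 -> exec (While b c) s2 T2 s3 ->
      exec (While b c) s1 (bcost b + T1 + T2)%N.+1 s3.

(** * Input and output *)

(* Integer bank 0 holds n, d, t; integer banks 1 and 2 hold the radii and the
   multiplicities; real bank 0 holds the coordinates of the points, one point
   after the other.  All other cells are 0. *)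
Definition init_state (R : realType) (I : nukc R) : state R :=
  State
    (fun a => nth 0%N (nth [::]
       [:: [:: npts I; ndim I; ntypes I];
           [seq brad i | i <- enum 'I_(ntypes I)];
           [seq mlt i | i <- enum 'I_(ntypes I)]] a))
    (fun a => nth 0 (nth [::]
       [:: [seq pts p 0 j | p <- enum 'I_(npts I), j <- enum 'I_(ndim I)]] a)).

(* The dilation is read off in real bank 1, cell 0, and the centers in real
   bank 2, one after the other, those of the first radius first, then
   those of the second, etc. *)
Definition out_dilation (R : realType) (s : state R) : R := rmem s 1%N 0%N.

Definition out_centers (R : realType) (I : nukc R) (s : state R) : centers I :=
  fun i j =>
    let offset := (\sum_(i' < ntypes I | (i' < i)%N) mlt i')%N in
    \row_(l < ndim I) rmem s 2%N ((offset + j) * ndim I + l)%N.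

Arguments out_centers {R} I s i j.

(** * Running time *)

Definition log2 (R : realType) (x : R) : R := ln x / ln 2.

(* 2^(C (k log k) / eps) d n.  The two truncations only matter for k = 1,
   where k log k vanishes, and for eps > 1, where 1 / eps would tend to 0; for
   k >= 2 and eps <= 1 they have no effect.  A multiplicative constant can be
   absorbed in C, since the exponent is at least C. *)
Definition time_bound (R : realType) (C eps : R) (k d n : nat) : R :=
  2 `^ (C * (k%:R * Num.max 1 (log2 k%:R) / Num.min 1 eps)) * d%:R * n%:R.

(* Main.v *)
(* No guess of the dilation is needed.  For a fixed assignment of points to
   balls, keep for every ball the (approximate) center of the minimum enclosing
   ball of the points assigned to it so far, and repeatedly take the point p
   that maximizes min_b |p - c_b| / r_b.  If p is assigned to the ball that
   covers it in a solution of dilation alpha, then, as long as the current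
   dilation exceeds (1 + e) alpha, the minimum enclosing ball of that ball's
   points grows, and it can do so only O(1/e) times before its radius would
   exceed alpha r_b.  Hence among the k^L words of length L = O(k/e) there is
   one that describes correct assignments all along and meets a solution of
   dilation at most (1 + e) alpha; trying all words and keeping the best
   solution works for all alpha at once.  The centers come from O(1/e^2) steps
   of the Badoiu-Clarkson iteration, which converges to the center of the
   minimum enclosing ball itself, with error r / sqrt i after i steps. *)
Require Import Defs.
From mathcomp Require Import all_boot all_order all_algebra.
From mathcomp Require Import all_classical all_reals all_analysis.
From mathcomp Require Import zify ring lra.

Set Implicit Arguments.
Unset Strict Implicit.
Unset Printing Implicit Defensive.

Import Order.TTheory GRing.Theory Num.Theory.
Import numFieldNormedType.Exports.

Local Open Scope classical_set_scope.
Local Open Scope ring_scope.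

(** * Minimum enclosing balls *)

(** Exact minimum enclosing balls, which exist by compactness, occur in the analysis only; the
    program sees Badoiu-Clarkson iterates instead. This costs half of the slack. With [M] about 16 /
    e and [M * M] iterations, the computed center is within (e / 16) rho of the exact one, so a
    point farther than (1 + e) rho from the former is farther than (1 + e / 2) rho from the latter.
    The potential argument, run with e / 2, then allows at most 8 / e < [M] points per ball, which
    is where the word length [k * M] comes from.

    A word is fixed before the run, whereas the right ball for a point depends on which point comes
    up. Since the selection of points is determined by the history, the word can be read off a run
    that is guided by a fixed covering solution.

    Distances are compared in squared form throughout; a root is taken only for the recorded
    dilation. Only one scan per step visits all n points, so the time is linear in n, and the
    factors polynomial in k M disappear in the exponent. *)

Section EnclosingBall.
Variables (R : realType) (d : nat).
Implicit Types (x y z c q : 'rV[R]_d) (S : seq 'rV[R]_d) (r t : R).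

Definition sqd x y : R := \sum_(j < d) (x 0 j - y 0 j) ^+ 2.

Lemma sqd_ge0 x y : 0 <= sqd x y.
Proof. by apply: sumr_ge0 => j _; exact: sqr_ge0. Qed.

Lemma sqdC x y : sqd x y = sqd y x.
Proof. by apply: eq_bigr => j _; rewrite -sqrrN opprB. Qed.

(** Stewart's identity. The triangle inequality, the optimality condition for the center and the
    Badoiu-Clarkson step are all derived from it. *)
Lemma sqd_convex t x y z :
  sqd z ((1 - t) *: x + t *: y) =
  (1 - t) * sqd z x + t * sqd z y - t * (1 - t) * sqd x y.
Proof.
rewrite /sqd !mulr_sumr -big_split /= -sumrB; apply: eq_bigr => j _.
by rewrite !mxE; ring.
Qed.

(** This is the limit t -> 0 without topology: if b < a, then t = (a - b) / (2 a) makes the left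
    side the midpoint of a and b, which exceeds b. *)
Lemma le_of_contractions (a b : R) :
  (forall t, 0 < t < 1 -> (1 - t) * a <= b) -> a <= b.
Proof.
move=> H; case: (leP a 0) => a0.
  by have := H (1 / 2) ltac:(lra); lra.
rewrite leNgt; apply/negP => ba.
have b0 : 0 <= b by have := H (1 / 2) ltac:(lra); lra.
have t0 : 0 < (a - b) / (2 * a) by rewrite divr_gt0; lra.
have tE : (a - b) / (2 * a) * (2 * a) = a - b by rewrite divfK //; lra.
have := H ((a - b) / (2 * a)).
by move: ((a - b) / (2 * a)) t0 tE => t t0 tE; nra.
Qed.

(* The convex combination of [x] and [y] with weights proportional to [b] and
   [a] is the one for which nonnegativity of [sqd z _] is the claim. *)
Lemma sqd_triangle x y z a b : 0 <= a -> 0 <= b ->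
  sqd z x <= a ^+ 2 -> sqd z y <= b ^+ 2 -> sqd x y <= (a + b) ^+ 2.
Proof.
move=> a0 b0 zx zy.
have key t : 0 < t < 1 -> t * (1 - t) * sqd x y <= (1 - t) * a ^+ 2 + t * b ^+ 2.
  move=> /andP[t0 t1]; have := sqd_convex t x y z.
  have := sqd_ge0 z ((1 - t) *: x + t *: y); nra.
have [a00|a00] := eqVneq a 0.
  apply: le_of_contractions => t t01; have := key t t01.
  by rewrite a00 add0r; case/andP: t01 => t0 t1; nra.
have [b00|b00] := eqVneq b 0.
  apply: le_of_contractions => t t01; have := key (1 - t) ltac:(lra).
  by rewrite b00 addr0; case/andP: t01 => t0 t1; nra.
have ap : 0 < a by rewrite lt_neqAle eq_sym a00.
have bp : 0 < b by rewrite lt_neqAle eq_sym b00.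
pose t := a / (a + b).
have t0 : 0 < t by rewrite divr_gt0 // addr_gt0.
have tE : t * (a + b) = a by rewrite divfK //; lra.
have t1 : t < 1 by nra.
have t1E : (1 - t) * (a + b) = b by rewrite mulrBl tE; ring.
have := key t ltac:(lra) => H.
have {H} : t * (1 - t) * (a + b) ^+ 2 * sqd x y <=
  ((1 - t) * (a + b) * a ^+ 2 + t * (a + b) * b ^+ 2) * (a + b).
  have abp : 0 <= (a + b) ^+ 2 by exact: sqr_ge0.
  by have := ler_wpM2l abp H; lra.
have -> : t * (1 - t) * (a + b) ^+ 2 = t * (a + b) * ((1 - t) * (a + b)) by ring.
rewrite tE t1E => H.
have abp : 0 < a * b by exact: mulr_gt0.
rewrite -(ler_pM2l abp); apply: le_trans H _.
by rewrite le_eqVlt; apply/orP; left; apply/eqP; ring.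
Qed.

(** The third clause is the optimality condition, written as a Pythagorean gap. It implies that the
    radius is minimal and the center unique, and it measures how much a change of center must
    enlarge the ball, which the convergence and the growth arguments both need. It also forces [S]
    to be nonempty. *)
Definition is_meb S c r :=
  [/\ 0 <= r, forall q, q \in S -> sqd q c <= r ^+ 2 &
    forall x, exists2 q, q \in S & r ^+ 2 + sqd x c <= sqd q x].

Fixpoint maxsqd S x : R :=
  if S is q :: S' then Num.max (sqd q x) (maxsqd S' x) else 0.

Lemma maxsqd_ge S x q : q \in S -> sqd q x <= maxsqd S x.
Proof.
elim: S => //= q' S IH; rewrite inE le_max => /orP[/eqP->|/IH->].
  by rewrite lexx.
by rewrite orbT.
Qed.

Lemma maxsqd_ge0 S x : 0 <= maxsqd S x.
Proof. by case: S => //= q S; rewrite le_max sqd_ge0. Qed.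

Lemma maxsqd_attained S x : S != [::] -> exists2 q, q \in S & maxsqd S x = sqd q x.
Proof.
elim: S => //= q [_ _|q' S IH _].
  by exists q; rewrite ?mem_head //=; apply/max_idPl; exact: sqd_ge0.
have [//|p pS pE] := IH; rewrite pE.
case: (leP (sqd q x) (sqd p x)) => _; first by exists p; rewrite // inE pS orbT.
by exists q; rewrite ?mem_head.
Qed.

Lemma sqd_continuous q : continuous (sqd q : 'rV[R]_d -> R).
Proof.
move=> x; apply: (@cvg_big _ _ _ _ _ _ _ (nbhs x)) => [|j _].
  exact: add_continuous.
under eq_fun do rewrite expr2.
by apply: cvgM; apply: cvgB; [exact: cvg_cst|exact: coord_continuous
                             |exact: cvg_cst|exact: coord_continuous].
Qed.

Lemma maxsqd_continuous S : continuous (maxsqd S : 'rV[R]_d -> R).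
Proof.
elim: S => [|q S IH].
  rewrite (_ : maxsqd [::] = cst 0); last exact/funext.
  exact: cst_continuous.
rewrite (_ : maxsqd (q :: S) = sqd q \max maxsqd S); last exact/funext.
by move=> x; apply: continuous_max; [exact: sqd_continuous|exact: IH].
Qed.

Lemma maxsqd_min S : S != [::] -> exists c, forall x, maxsqd S c <= maxsqd S x.
Proof.
move=> S0.
pose B := \sum_(q <- S) \sum_(j < d) `|q 0 j|.
have B0 : 0 <= B by apply: sumr_ge0 => q _; exact: sumr_ge0.
have SB q j : q \in S -> `|q 0 j| <= B.
  move=> qS; apply: le_trans (_ : \sum_(j < d) `|q 0 j| <= _).
    by rewrite (bigD1 j) //= lerDl sumr_ge0.
  rewrite /B (big_rem q) //= lerDl; apply: sumr_ge0 => q' _; exact: sumr_ge0.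
pose box := [set v : 'rV[R]_d | forall i, `[- B, B]%classic (v ord0 i)].
have cbox : compact box.
  by apply: (@rV_compact _ _ (fun=> `[- B, B]%classic)) => _; exact: segment_compact.
have box0 : box !=set0.
  by exists 0 => i /=; rewrite mxE in_itv /=; apply/andP; split; lra.
have [] := @EVT_min_rV R d (maxsqd S) box box0 cbox.
  by apply: continuous_subspaceT; exact: maxsqd_continuous.
move=> c _ cmin; exists c => x.
(* Clamping to the box brings no coordinate farther from that of a point of [S], so the minimum over
   the compact box is global. *)
pose x' := \row_j Num.max (- B) (Num.min B (x 0 j)).
apply: (@le_trans _ _ (maxsqd S x')).
  apply: cmin; rewrite inE => i /=; rewrite mxE in_itv /=.
  by rewrite le_max lexx /= ge_max ge_min lexx /= andbT; lra.
have [q qS ->] := maxsqd_attained x' S0.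
apply: le_trans (maxsqd_ge x qS); apply: ler_sum => j _; rewrite mxE.
have := SB q j qS; rewrite ler_norml => /andP[qB1 qB2].
rewrite /Num.max /Num.min; case: ifP; case: ifP => h1 h2; try nra.
Qed.

(** The witness for [x] is the point of [S] farthest from [x]. Comparing the minimizer [c] of
    [maxsqd S] with the point at parameter t on the segment from [c] to [x] gives the gap with a
    factor 1 - t, and then t -> 0. *)
Lemma meb_exists S : S != [::] -> exists c r, is_meb S c r.
Proof.
move=> S0; have [c cmin] := maxsqd_min S0.
have r2 : Num.sqrt (maxsqd S c) ^+ 2 = maxsqd S c by rewrite sqr_sqrtr ?maxsqd_ge0.
exists c, (Num.sqrt (maxsqd S c)); split; rewrite ?sqrtr_ge0 ?r2 //.
  by move=> q; exact: maxsqd_ge.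
move=> x; have [q qS qE] := maxsqd_attained x S0.
exists q => //; rewrite -qE -lerBrDl sqdC.
apply: le_of_contractions => t /andP[t0 t1].
have [q' q'S] := maxsqd_attained ((1 - t) *: c + t *: x) S0.
rewrite sqd_convex; have := cmin ((1 - t) *: c + t *: x).
move=> + E; rewrite {}E.
have := maxsqd_ge c q'S; have := maxsqd_ge x q'S.
by have := sqd_ge0 c x; nra.
Qed.

Lemma meb_radius_le S c r x rho : is_meb S c r -> 0 <= rho ->
  (forall q, q \in S -> sqd q x <= rho ^+ 2) -> r <= rho.
Proof.
move=> [r0 _ /(_ x)[q qS H]] rho0 /(_ _ qS) Hq.
rewrite -(@ler_pXn2r _ 2) ?nnegrE //; apply: le_trans Hq.
by apply: le_trans H; rewrite lerDl sqd_ge0.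
Qed.

(* A farthest point [q] from [x] is at squared distance at least
   [r ^+ 2 + sqd x c]; this is what makes [i ^+ 2 * sqd x_i c] grow only
   linearly under the Badoiu-Clarkson iteration. *)
Lemma badoiu_clarkson_step S c r x q i : is_meb S c r -> q \in S ->
  (forall q', q' \in S -> sqd q' x <= sqd q x) ->
  i%:R ^+ 2 * sqd x c <= i%:R * r ^+ 2 ->
  i.+1%:R ^+ 2 * sqd (i.+1%:R^-1 *: (i%:R *: x + q)) c <= i.+1%:R * r ^+ 2.
Proof.
move=> [r0 Sc Sx] qS far ix.
have [q' q'S Hq'] := Sx x; have {Hq' far} H := le_trans Hq' (far _ q'S).
have i0 : 0 <= i%:R :> R by [].
have i1 : i.+1%:R != 0 :> R by rewrite pnatr_eq0.
pose t : R := i.+1%:R^-1.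
have tE : t * (i%:R + 1) = 1 by rewrite natr1 /t mulVf.
have -> : i.+1%:R^-1 *: (i%:R *: x + q) = (1 - t) *: x + t *: q.
  rewrite scalerDr scalerA; congr (_ *: _ + _).
  by rewrite -/t; lra.
rewrite sqdC sqd_convex -natr1.
rewrite (sqdC c x) (sqdC c q) (sqdC x q).
have e1 : (i%:R + 1) * (1 - t) = i%:R by rewrite mulrBr (mulrC _ t) tE; ring.
set X := sqd x c in ix H *; set Y := sqd q x in H *.
have := Sc _ qS; set Z := sqd q c => ZH.
have -> : (i%:R + 1) ^+ 2 * ((1 - t) * X + t * Z - t * (1 - t) * Y) =
  (i%:R + 1) * ((i%:R + 1) * (1 - t)) * X + (i%:R + 1) * (t * (i%:R + 1)) * Z
    - (t * (i%:R + 1)) * ((i%:R + 1) * (1 - t)) * Y by ring.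
by rewrite tE e1; nra.
Qed.

End EnclosingBall.

(** * Growth of the enclosing ball under insertion of a far point *)

Section Potential.
Variables (R : realType) (d : nat).
Implicit Types (p c : 'rV[R]_d) (S : seq 'rV[R]_d).

(* Normalized to [rho = 1], [g := 1 + e - r] satisfies [g' + g' ^+ 2 / 2 <= g]
   when a point at distance at least [1 + e] from the center is added, so
   [1 / g] grows linearly.  This is why [O(1 / e)] insertions suffice. *)
Lemma meb_potential_step S p c r c' r' (rho e : R) m :
  is_meb S c r -> is_meb (rcons S p) c' r' -> 0 < rho -> r' <= rho -> 0 < e ->
  ((1 + e) * rho) ^+ 2 <= sqd p c ->
  m.+1%:R * ((1 + e) * rho - r) <= 4 * rho ->
  m.+2%:R * ((1 + e) * rho - r') <= 4 * rho.
Proof.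
move=> [r0 Sc /(_ c')[q qS Hq]] [r'0 S'c' _] rho0 r'rho e0 far Hm.
pose D := Num.sqrt (sqd c' c).
have D0 : 0 <= D by exact: sqrtr_ge0.
have DE : D ^+ 2 = sqd c' c by rewrite sqr_sqrtr ?sqd_ge0.
have pc' : sqd c' p <= r' ^+ 2.
  by rewrite sqdC; apply: S'c'; rewrite mem_rcons mem_head.
have {}Hq : r ^+ 2 + D ^+ 2 <= r' ^+ 2.
  rewrite DE; apply: le_trans Hq _.
  by apply: S'c'; rewrite mem_rcons inE qS orbT.
(* The new point is within r' of the new center, which is at distance [D] from the old one. *)
have tri : (1 + e) * rho <= r' + D.
  rewrite -(@ler_pXn2r _ 2) ?nnegrE ?addr_ge0 //; last by nra.
  apply: le_trans far _; apply: (sqd_triangle r'0 D0 pc').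
  by rewrite DE.
have rr' : r <= r' by rewrite -(@ler_pXn2r _ 2) ?nnegrE //; nra.
set g' := (1 + e) * rho - r'.
have g'0 : 0 < g' by rewrite /g'; nra.
have g'D : g' <= D by rewrite /g'; lra.
(* Here g' <= D, and D^2 <= r'^2 - r^2 = (r' + r) (r' - r) with both radii at most rho. *)
have step : g' ^+ 2 <= 2 * rho * (r' - r) by nra.
move: Hm; have -> : (1 + e) * rho - r = g' + (r' - r) by rewrite /g'; ring.
rewrite -[m.+2%:R]natr1; set M : R := m.+1%:R => Hm.
have M1 : 1 <= M by rewrite /M -natr1 lerDr.
(* Eliminating r' - r from [Hm] and [step] bounds M (2 rho g' + g'^2) by 8 rho^2. If g' > 4 rho / (M
   + 1), this yields M^2 + 3 M < (M + 1)^2, which is false for M >= 1. The constant 4 is the least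
   one for which this works at M = 1. *)
rewrite leNgt; apply/negP => big.
have h1 : M * (2 * rho * g' + g' ^+ 2) <= 8 * rho ^+ 2.
  have : M * g' ^+ 2 <= M * (2 * rho * (r' - r)) by rewrite ler_pM2l //; lra.
  have : 2 * rho * (M * (g' + (r' - r))) <= 2 * rho * (4 * rho).
    by rewrite ler_pM2l //; lra.
  nra.
set y := (M + 1) * g' in big.
have h2 : M * (2 * rho * (M + 1) * y + y ^+ 2) <= 8 * rho ^+ 2 * (M + 1) ^+ 2.
  rewrite /y; have M2 : 0 <= (M + 1) ^+ 2 by exact: sqr_ge0.
  by have := ler_wpM2r M2 h1; lra.
have h3 : (4 * rho) ^+ 2 < y ^+ 2 by nra.
have h4 : 2 * rho * (M + 1) * (4 * rho) < 2 * rho * (M + 1) * y.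
  by rewrite ltr_pM2l //; nra.
have h5 : M * (2 * rho * (M + 1) * (4 * rho) + (4 * rho) ^+ 2) <
          M * (2 * rho * (M + 1) * y + y ^+ 2).
  by rewrite ltr_pM2l; lra.
have : 0 < rho ^+ 2 by rewrite exprn_gt0.
nra.
Qed.

End Potential.

(** * The algorithm as a mathematical function of the word *)

Section Algorithm.
Variables (R : realType) (d : nat) (P : nat -> 'rV[R]_d) (n k N : nat).
Variable rad : nat -> nat.
Implicit Types (f : nat -> R) (xs : seq nat) (H : seq (nat * nat)).
Implicit Type w : nat -> nat.

Definition amax_step f (a : R * nat) x := if f x <= a.1 then a else (f x, x).

(** The start value -1 lies below every squared distance, so the first element of a nonempty list
    always replaces it. The fold mirrors the loop of the program, ties included. *)
Definition amax f xs := foldl (amax_step f) (-1, 0%N) xs.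

Definition assigned H b := [seq x.1 | x <- H & x.2 == b].

Definition bc_step H b (i : nat) (c : 'rV[R]_d) : 'rV[R]_d :=
  i.+1%:R^-1 *:
    (i%:R *: c + P (amax (fun q => sqd (P q) c) (assigned H b)).2).

(** The start vector 0 is forgotten at once, since step 0 gives the old center weight 0. For a ball
    without points [amax] returns index 0, and the center becomes [P 0]. *)
Fixpoint bc H b i : 'rV[R]_d :=
  if i is i'.+1 then bc_step H b i' (bc H b i') else 0.

Definition scaled_sqd (c : nat -> 'rV[R]_d) p b :=
  sqd (P p) (c b) / (rad b * rad b)%:R.

Fixpoint rmin f m : R :=
  if m is b.+1 then
    if (b == 0)%N || (f b <= rmin f b) then f b else rmin f b
  else 0.

Definition worst H :=
  amax (fun p => rmin (scaled_sqd (fun b => bc H b N) p) k) (iota 0 n).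

Definition dil H := Num.sqrt (worst H).1.

Fixpoint hist w j :=
  if j is j'.+1 then rcons (hist w j') ((worst (hist w j')).2, w j')
  else [::].

Lemma size_hist w j : size (hist w j) = j.
Proof. by elim: j => //= j IH; rewrite size_rcons IH. Qed.

Lemma amaxP f xs : (forall x, x \in xs -> 0 <= f x) -> xs != [::] ->
  [/\ (amax f xs).2 \in xs, (amax f xs).1 = f (amax f xs).2 &
      forall x, x \in xs -> f x <= (amax f xs).1].
Proof.
elim/last_ind: xs => // xs x IH f0 _; rewrite /amax foldl_rcons -/(amax f xs).
have fx : 0 <= f x by apply: f0; rewrite mem_rcons mem_head.
have [->|xs0] := eqVneq xs [::].
  rewrite /amax_step /= ifF ?mem_head //=; last by apply/negbTE; rewrite -ltNge; lra.
  by split=> // y; rewrite inE => /eqP ->.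
have [|//|IH1 IH2 IH3] := IH.
  by move=> y yxs; apply: f0; rewrite mem_rcons inE yxs orbT.
rewrite /amax_step; case: (leP (f x) (amax f xs).1) => fxm /=; split=> //.
- by rewrite mem_rcons inE IH1 orbT.
- by move=> y; rewrite mem_rcons inE => /orP[/eqP->//|/IH3].
- by rewrite mem_rcons mem_head.
- move=> y; rewrite mem_rcons inE => /orP[/eqP->//|/IH3 h].
  exact: le_trans h (ltW fxm).
Qed.

Lemma rmin_le f m b : (b < m)%N -> rmin f m <= f b.
Proof.
elim: m => //= m IH; rewrite ltnS leq_eqVlt => /orP[/eqP->|bm].
  by case: ifP => // /negbT; rewrite negb_or -ltNge => /andP[_ /ltW].
have h := IH bm; case: ifP => // /orP[/eqP m0|h']; first by rewrite m0 in bm.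
exact: le_trans h.
Qed.

Lemma rmin_attained f m : (0 < m)%N -> exists2 b, (b < m)%N & rmin f m = f b.
Proof.
elim: m => //= m IH _; case: ifP => [_|]; first by exists m.
move/negbT; rewrite negb_or -lt0n => /andP[/IH[b bm ->] _].
by exists b => //; exact: ltnW.
Qed.

Lemma scaled_sqd_ge0 c p b : 0 <= scaled_sqd c p b.
Proof. by rewrite /scaled_sqd divr_ge0 // sqd_ge0. Qed.

Lemma rmin_ge0 f m : (forall b, 0 <= f b) -> 0 <= rmin f m.
Proof. by move=> f0; elim: m => //= m IH; case: ifP. Qed.

Hypotheses (n_gt0 : (0 < n)%N) (k_gt0 : (0 < k)%N).
Hypothesis rad_gt0 : forall b, (b < k)%N -> (0 < rad b)%N.

Lemma worstP H : [/\ ((worst H).2 < n)%N,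
  (worst H).1 = rmin (scaled_sqd (fun b => bc H b N) (worst H).2) k &
  forall p, (p < n)%N -> rmin (scaled_sqd (fun b => bc H b N) p) k <= (worst H).1].
Proof.
have [] := @amaxP (fun p => rmin (scaled_sqd (fun b => bc H b N) p) k) (iota 0 n).
- by move=> p _; apply: rmin_ge0 => b; exact: scaled_sqd_ge0.
- by rewrite -size_eq0 size_iota -lt0n.
rewrite -/(worst H) mem_iota => W1 W2 W3; split=> // p pn.
by apply: W3; rewrite mem_iota.
Qed.

(** This holds for every history: a wrong guess of the word affects the dilation but never
    feasibility. *)
Lemma dil_covers H p : (p < n)%N ->
  exists2 b, (b < k)%N & sqd (P p) (bc H b N) <= (dil H * (rad b)%:R) ^+ 2.
Proof.
move=> pn; have [_ _ /(_ _ pn) W] := worstP H.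
have [b bk E] := rmin_attained (scaled_sqd (fun b => bc H b N) p) k_gt0.
have r0 : 0 < (rad b)%:R ^+ 2 :> R by rewrite exprn_gt0 // ltr0n rad_gt0.
exists b => //; move: W; rewrite E /scaled_sqd natrM -expr2 ler_pdivrMr // => W.
rewrite exprMn sqr_sqrtr //.
apply: le_trans (_ : rmin (scaled_sqd (fun b => bc H b N) p) k <= _).
  by apply: rmin_ge0 => b'; exact: scaled_sqd_ge0.
by have [_ _ /(_ _ pn)] := worstP H.
Qed.

(** The minimum over all balls of the scaled distance of the worst point exceeds [a ^+ 2]. Hence the
    point is far from every ball, in particular from the one to which it will be assigned. *)
Lemma worst_uncovered H a b : 0 <= a -> a < dil H -> (b < k)%N ->
  (a * (rad b)%:R) ^+ 2 < sqd (P (worst H).2) (bc H b N).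
Proof.
move=> a0 aH bk; have [_ E _] := worstP H.
have r0 : 0 < (rad b)%:R ^+ 2 :> R by rewrite exprn_gt0 // ltr0n rad_gt0.
have : a ^+ 2 < (worst H).1.
  have v0 : 0 <= (worst H).1.
    by rewrite E; apply: rmin_ge0 => b'; exact: scaled_sqd_ge0.
  by rewrite -(sqr_sqrtr v0) ltr_pXn2r ?nnegrE ?sqrtr_ge0.
rewrite E => h; have := lt_le_trans h (rmin_le _ bk).
by rewrite /scaled_sqd natrM -expr2 ltr_pdivlMr // exprMn.
Qed.

(** Because of the factor [i%:R ^+ 2] the bound is trivial at i = 0, so the start vector may be
    arbitrarily far from the points. *)
Lemma bc_close H b c r i : is_meb [seq P q | q <- assigned H b] c r ->
  i%:R ^+ 2 * sqd (bc H b i) c <= i%:R * r ^+ 2.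
Proof.
move=> meb; elim: i => [|i IH]; first by rewrite expr0n /= !mul0r.
have xs0 : assigned H b != [::].
  apply/eqP => E; case: meb => _ _ /(_ c)[q]; by rewrite E.
have [A1 A2 A3] := @amaxP (fun q => sqd (P q) (bc H b i)) _
  (fun q _ => sqd_ge0 _ _) xs0.
apply: (badoiu_clarkson_step meb _ _ IH).
  by apply: map_f; exact: A1.
by move=> _ /mapP[q qS ->]; rewrite -A2; apply: A3.
Qed.

End Algorithm.

(** * Existence of a good word *)

Section Progress.
Variables (R : realType) (d : nat) (P : nat -> 'rV[R]_d) (n k M : nat).
Variable rad : nat -> nat.
Hypotheses (n_gt0 : (0 < n)%N) (k_gt0 : (0 < k)%N).
Hypothesis rad_gt0 : forall b, (b < k)%N -> (0 < rad b)%N.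
Variables (e alpha : R) (cs : nat -> 'rV[R]_d) (sg : nat -> nat).
Hypotheses (e_gt0 : 0 < e) (e_le1 : e <= 1) (alpha_gt0 : 0 < alpha).
Hypothesis M_large : 16 <= M%:R * e.
Hypothesis sg_lt : forall p, (p < n)%N -> (sg p < k)%N.
Hypothesis cs_covers : forall p, (p < n)%N ->
  sqd (P p) (cs (sg p)) <= (alpha * (rad (sg p))%:R) ^+ 2.

Let wst H := worst P n k (M * M) rad H.

(** The run in which the assignment [sg] of a covering solution acts as an oracle for the ball of
    each selected point. *)
Fixpoint opt_hist j :=
  if j is j'.+1 then
    rcons (opt_hist j') ((wst (opt_hist j')).2, sg (wst (opt_hist j')).2)
  else [::].

Lemma assigned_rcons H x b :
  assigned (rcons H x) b =
  if x.2 == b then rcons (assigned H b) x.1 else assigned H b.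
Proof.
by rewrite /assigned filter_rcons; case: ifP => // _; rewrite map_rcons.
Qed.

Lemma opt_hist_assigned j b p : p \in assigned (opt_hist j) b ->
  (p < n)%N /\ sg p = b.
Proof.
elim: j => //= j IH; rewrite assigned_rcons /=; case: eqP => // bE.
rewrite mem_rcons inE => /orP[/eqP->|]; last exact: IH.
by split=> //; have [] := worstP P k (M * M) rad n_gt0 (opt_hist j).
Qed.

Lemma size_assigned_opt_hist j :
  (\sum_(b < k) size (assigned (opt_hist j) b) = j)%N.
Proof.
elim: j => [|j IH] /=; first by rewrite big1.
have wn : ((wst (opt_hist j)).2 < n)%N.
  by have [] := worstP P k (M * M) rad n_gt0 (opt_hist j).
pose b0 := Ordinal (sg_lt wn).
rewrite -[in RHS]IH (bigD1 b0) //= [in RHS](bigD1 b0) //=.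
rewrite assigned_rcons /= eqxx size_rcons addSn; congr (_ + _).+1.
apply: eq_bigr => b bb0; rewrite assigned_rcons /= ifF //.
by apply/negbTE; apply: contra bb0 => /eqP E; apply/eqP/val_inj.
Qed.

Let rho b := alpha * (rad b)%:R.

Lemma opt_hist_radius j b c r : (b < k)%N ->
  is_meb [seq P q | q <- assigned (opt_hist j) b] c r -> r <= rho b.
Proof.
move=> bk meb; apply: (@meb_radius_le _ _ _ _ _ (cs b) _ meb).
  by rewrite mulr_ge0 // ltW.
move=> _ /mapP[q /opt_hist_assigned[qn <-] ->]; exact: cs_covers.
Qed.

Lemma opt_hist_potential j b c r : (b < k)%N ->
  (forall i, (i < j)%N -> (1 + e) * alpha < dil P n k (M * M) rad (opt_hist i)) ->
  is_meb [seq P q | q <- assigned (opt_hist j) b] c r ->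
  (size (assigned (opt_hist j) b))%:R * ((1 + e / 2) * rho b - r) <= 4 * rho b.
Proof.
move=> bk; have rho0 : 0 < rho b by rewrite mulr_gt0 // ltr0n rad_gt0.
elim: j c r => [|j IH] c r unc meb; first by rewrite /= mul0r; lra.
have radle := opt_hist_radius bk meb.
move: meb radle; rewrite /= assigned_rcons /=; case: eqP => [sb|_]; last first.
  by move=> meb _; apply: (IH c r) => // i ij; apply: unc; exact: ltnW.
have {}unc0 : forall i, (i < j)%N ->
    (1 + e) * alpha < dil P n k (M * M) rad (opt_hist i).
  by move=> i ij; apply: unc; exact: ltnW.
rewrite map_rcons size_rcons => meb radle.
(* The first point of a ball has no previous enclosing ball to compare with; there the potential is
   at most (1 + e / 2) rho <= 2 rho. *)
case E : (assigned (opt_hist j) b) => [|q xs].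
  have : e * rho b <= rho b by rewrite ler_piMl // ltW.
  by rewrite mul1r; case: meb => r0 _ _; lra.
have [c0 [r0 meb0]] : exists c0 r0,
    is_meb [seq P q | q <- assigned (opt_hist j) b] c0 r0.
  by apply: meb_exists; rewrite E.
have rad0 := opt_hist_radius bk meb0.
have IH0 := IH c0 r0 unc0 meb0.
rewrite -E; move: IH0; rewrite [size _]/(size (assigned (opt_hist j) b)) E /=.
apply: (meb_potential_step meb0 meb) => //; first by rewrite divr_gt0.
have M0 : 0 < M%:R :> R.
  by rewrite ltr0n lt0n; apply: contraTneq M_large => ->; rewrite mul0r -ltNge.
(* After [M * M] iterations the error is at most r0 / M, and 1 / M <= e / 16 by [M_large]. *)
have close : sqd (bc P (opt_hist j) b (M * M)) c0 <= (rho b * e / 16) ^+ 2.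
  have r00 : 0 <= r0 by case: meb0.
  have := bc_close (M * M) meb0; set X := sqd _ _; rewrite natrM => h.
  have M2 : 0 < M%:R ^+ 2 :> R by rewrite exprn_gt0.
  have {}h : M%:R ^+ 2 * X <= r0 ^+ 2.
    rewrite -(ler_pM2l M2); apply: le_trans h; rewrite le_eqVlt.
    by apply/orP; left; apply/eqP; ring.
  rewrite -(ler_pM2l M2); apply: le_trans h _.
  rewrite -exprMn ler_pXn2r ?nnegrE //; last by rewrite !mulr_ge0 // ltW.
  apply: le_trans rad0 _.
  have -> : M%:R * (rho b * e / 16) = rho b * (M%:R * e / 16) by ring.
  by rewrite ler_peMr ?(ltW rho0) // ler_pdivlMr // mul1r.
have far : ((1 + e) * rho b) ^+ 2 <
    sqd (P (wst (opt_hist j)).2) (bc P (opt_hist j) b (M * M)).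
  rewrite /rho mulrA; apply: (worst_uncovered n_gt0 rad_gt0) => //.
    by rewrite mulr_ge0 ?addr_ge0 // ltW.
  exact: unc.
(* A point within (1 + e / 2) rho of the exact center would be within (1 + e / 2 + e / 16) rho <= (1
   + e) rho of the computed one. *)
rewrite leNgt; apply/negP => near; move: far; apply/negP; rewrite -leNgt.
apply: (le_trans (@sqd_triangle _ _ _ _ c0
  ((1 + e / 2) * rho b) (rho b * e / 16) _ _ _ _)).
- by rewrite mulr_ge0 ?addr_ge0 ?divr_ge0 // ltW.
- by rewrite !mulr_ge0 // ltW.
- by rewrite sqdC ltW.
- by rewrite sqdC.
- have eb : 0 < e * rho b by rewrite mulr_gt0.
  rewrite ler_pXn2r ?nnegrE //; last 2 first.
  + by rewrite addr_ge0 // !mulr_ge0 ?addr_ge0 ?divr_ge0 // ltW.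
  + by rewrite mulr_ge0 ?addr_ge0 // ltW.
  by move: (rho b) rho0 eb => rb rb0 eb; lra.
Qed.

Lemma exists_good_history : exists w : nat -> nat,
  (forall j, (w j < k)%N) /\
  exists2 j, (j < k * M)%N &
    dil P n k (M * M) rad (hist P n k (M * M) rad w j) <= (1 + e) * alpha.
Proof.
exists (fun j => sg (wst (opt_hist j)).2); split=> [j|].
  by apply: sg_lt; have [] := worstP P k (M * M) rad n_gt0 (opt_hist j).
have histE j : hist P n k (M * M) rad (fun j => sg (wst (opt_hist j)).2) j = opt_hist j.
  by elim: j => //= j ->.
apply: contrapT => Hno.
have unc i : (i < k * M)%N -> (1 + e) * alpha < dil P n k (M * M) rad (opt_hist i).
  move=> ikM; rewrite ltNge; apply/negP => h; apply: Hno.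
  by exists i => //; rewrite histE.
have M0 : (0 < M)%N.
  by rewrite lt0n; apply: contraTneq M_large => ->; rewrite mul0r -ltNge.
(* With r <= rho the potential bound for m points reads m (e / 2) rho <= 4 rho, hence m e <= 8 < 16
   <= M e. Summing over the balls then gives less than the k M insertions made. *)
have small (b : 'I_k) : (size (assigned (opt_hist (k * M)) b) <= M.-1)%N.
  rewrite -ltnS prednK //; case E : (assigned _ _) => [|q xs] //.
  rewrite -E; have [c [r meb]] : exists c r,
      is_meb [seq P q | q <- assigned (opt_hist (k * M)) b] c r.
    by apply: meb_exists; rewrite E.
  have := opt_hist_potential (ltn_ord b) unc meb.
  have := opt_hist_radius (ltn_ord b) meb.
  have rho0 : 0 < rho b by rewrite mulr_gt0 // ltr0n rad_gt0.
  rewrite -(ltr_nat R); set m : R := (size _)%:R => rle pot.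
  have m0 : 0 <= m by rewrite ler0n.
  have mr : 0 <= m * (rho b - r) by rewrite mulr_ge0 // subr_ge0.
  have : m * (e / 2 * rho b) <= 4 * rho b.
    apply: le_trans pot; rewrite -subr_ge0; apply: le_trans mr _.
    by rewrite le_eqVlt; apply/orP; left; apply/eqP; ring.
  rewrite mulrA ler_pM2r // => h.
  have : m * e < M%:R * e.
    apply: lt_le_trans M_large; rewrite mulrA ler_pdivrMr // in h.
    by apply: le_lt_trans h _; rewrite -natrM ltr_nat.
  by rewrite ltr_pM2r.
have := size_assigned_opt_hist (k * M).
have : (\sum_(b < k) size (assigned (opt_hist (k * M)) b) <= \sum_(b < k) M.-1)%N.
  by apply: leq_sum => b _; exact: small.
rewrite sum_nat_const card_ord => h E; rewrite E in h.
by move: h; rewrite leq_pmul2l //; case: (M) M0 => // m' _; rewrite ltnn.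
Qed.

End Progress.

(** * Timed Hoare logic *)

Section TimedHoare.
Variable R : realType.
Implicit Types (s : state R) (A B : seq nat) (Q : state R -> Prop).

(** Total correctness with a budget. As execution is deterministic, exhibiting one run describes the
    run. *)
Definition wp (c : cmd) s (T : nat) Q :=
  exists T' s', [/\ exec c s T' s', (T' <= T)%N & Q s'].

Definition seti s a i v := State (upd (imem s) a i v) (rmem s).
Definition setr s a i v := State (imem s) (upd (rmem s) a i v).

(** A frame condition by banks. Bank numbers are literals of the program, so [A] and [B] are
    concrete lists and the membership side conditions are settled by computation. *)
Definition keeps A B s s' :=
  (forall a, a \notin A -> imem s' a = imem s a) /\
  (forall b, b \notin B -> rmem s' b = rmem s b).

Lemma keepsI A B s s' : keeps A B s s' ->
  forall a, a \notin A -> imem s' a = imem s a.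
Proof. by case. Qed.

Lemma keepsR A B s s' : keeps A B s s' ->
  forall a, a \notin B -> rmem s' a = rmem s a.
Proof. by case. Qed.

Arguments keepsI {A B s s'} _ a%_N _.
Arguments keepsR {A B s s'} _ a%_N _.

Lemma keeps_refl A B s : keeps A B s s.
Proof. by []. Qed.

Lemma keeps_trans A B s1 s2 s3 :
  keeps A B s1 s2 -> keeps A B s2 s3 -> keeps A B s1 s3.
Proof.
move=> [i12 r12] [i23 r23]; split=> a aA; first by rewrite i23 ?i12.
by rewrite r23 ?r12.
Qed.

Lemma keeps_sub A B A' B' s s' : all (mem A') A -> all (mem B') B ->
  keeps A B s s' -> keeps A' B' s s'.
Proof.
move=> /allP AA /allP BB [iK rK]; split=> a aN.
  by apply: iK; apply: contra aN => /AA.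
by apply: rK; apply: contra aN => /BB.
Qed.

Lemma keeps_seti A B s a i v : a \in A -> keeps A B s (seti s a i v).
Proof.
move=> aA; split=> // a' a'A /=.
by rewrite /upd; case: eqP a'A => // ->; rewrite aA.
Qed.

Lemma keeps_setr A B s a i v : a \in B -> keeps A B s (setr s a i v).
Proof.
move=> aA; split=> // a' a'A /=.
by rewrite /upd; case: eqP a'A => // ->; rewrite aA.
Qed.

Lemma wp_le c s T T' Q : wp c s T Q -> (T <= T')%N -> wp c s T' Q.
Proof.
move=> [T1 [s1 [e1 le1 q1]]] TT'; exists T1, s1; split=> //.
exact: leq_trans TT'.
Qed.

Lemma wp_post c s T Q Q' : wp c s T Q -> (forall s', Q s' -> Q' s') ->
  wp c s T Q'.
Proof. by move=> [T1 [s1 [e1 le1 q1]]] QQ; exists T1, s1; split=> //; apply: QQ. Qed.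

Lemma wp_skip s Q : Q s -> wp Skip s 1 Q.
Proof. by move=> q; exists 1%N, s; split=> //; constructor. Qed.

Lemma wp_iset a e1 e2 s Q : Q (seti s a (ieval s e1) (ieval s e2)) ->
  wp (ISet a e1 e2) s (icost e1 + icost e2).+1 Q.
Proof. by move=> q; eexists _, _; split; first exact: ExecISet. Qed.

Lemma wp_rset a e1 e2 s Q : Q (setr s a (ieval s e1) (reval s e2)) ->
  wp (RSet a e1 e2) s (icost e1 + rcost e2).+1 Q.
Proof. by move=> q; eexists _, _; split; first exact: ExecRSet. Qed.

Lemma wp_seq c1 c2 s T1 T2 Q1 Q : wp c1 s T1 Q1 ->
  (forall s1, Q1 s1 -> wp c2 s1 T2 Q) -> wp (Seq c1 c2) s (T1 + T2) Q.
Proof.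
move=> [T1' [s1 [e1 le1 q1]]] /(_ _ q1) [T2' [s2 [e2 le2 q2]]].
exists (T1' + T2')%N, s2; split=> //; first exact: ExecSeq e1 e2.
exact: leq_add.
Qed.

(** Adding the budgets of the branches, rather than taking their maximum, keeps all time bounds
    polynomial expressions. *)
Lemma wp_if b c1 c2 s T1 T2 Q :
  (beval s b -> wp c1 s T1 Q) -> (~~ beval s b -> wp c2 s T2 Q) ->
  wp (If b c1 c2) s (bcost b + (T1 + T2)).+1 Q.
Proof.
case: (boolP (beval s b)) => bE H1 H2.
  have [T1' [s1 [e1 le1 q1]]] := H1 isT.
  exists (bcost b + T1').+1, s1; split=> //; last by lia.
  by apply: ExecIf; rewrite bE.
have [T1' [s1 [e1 le1 q1]]] := H2 isT.
exists (bcost b + T1').+1, s1; split=> //; last by lia.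
by apply: ExecIf; rewrite (negbTE bE).
Qed.

Definition V a := IGet a (INat 0).
Definition RV a := RGet a (INat 0).
Definition SetV a e := ISet a (INat 0) e.
Definition SetR a e := RSet a (INat 0) e.

Definition For i e body :=
  Seq (SetV i (INat 0))
    (While (BNot (BILe e (V i)))
       (Seq body (SetV i (IAdd (V i) (INat 1))))).

(** The guard evaluates [e] anew in every round, hence the hypothesis on all states within the frame
    and the repeated [icost e]. Besides it, a round costs 5 for the test and 6 for the increment; 8
    is 3 for the initialization plus 5 for the last test. *)
Lemma wp_for i e body A B (Inv : nat -> state R -> Prop) s m Tb :
  i \notin A ->
  (forall s1, keeps (i :: A) B s s1 -> ieval s1 e = m) ->
  Inv 0%N (seti s i 0 0) ->
  (forall j s1, (j < m)%N -> keeps (i :: A) B s s1 -> imem s1 i 0%N = j ->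
     Inv j s1 ->
     wp body s1 Tb (fun s2 => keeps A B s1 s2 /\ Inv j.+1 (seti s2 i 0 j.+1))) ->
  wp (For i e body) s (m * (Tb + icost e + 11) + icost e + 8)
    (fun s' => keeps (i :: A) B s s' /\ Inv m s').
Proof.
move=> iA eE I0 step.
suff loop r : forall j s1, (j + r = m)%N -> keeps (i :: A) B s s1 ->
    imem s1 i 0%N = j -> Inv j s1 ->
    wp (While (BNot (BILe e (V i))) (Seq body (SetV i (IAdd (V i) (INat 1)))))
      s1 (r * (Tb + icost e + 11) + icost e + 5)
      (fun s' => keeps (i :: A) B s s' /\ Inv m s').
  rewrite /For.
  apply: (@wp_le _ _ (3 + (m * (Tb + icost e + 11) + icost e + 5))); last by lia.
  apply: (@wp_seq _ _ _ _ _ (fun s1 => s1 = seti s i 0 0)).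
    exact: wp_iset.
  move=> _ ->; apply: (loop m 0%N) => //; last by rewrite /= /upd !eqxx.
  by apply: keeps_seti; exact: mem_head.
elim: r => [|r IH] j s1.
  rewrite addn0 => -> Ks1 ij Ij.
  exists (bcost (BNot (BILe e (V i)))).+1, s1; split=> //.
    by apply: ExecWhileFalse; rewrite /= eE // ij leqnn.
  by rewrite /=; lia.
move=> jr Ks1 ij Ij.
have jm : (j < m)%N by lia.
have [T1 [s2 [e1 le1 [K2 I2]]]] := step j s1 jm Ks1 ij Ij.
have i2 : imem s2 i = imem s1 i by case: K2 => + _; apply.
have K3 : keeps (i :: A) B s (seti s2 i 0 j.+1).
  apply: keeps_trans Ks1 _; apply: (@keeps_trans _ _ _ s2).
    by apply: keeps_sub K2; apply/allP => x xA //; apply/predU1P; right.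
  by apply: keeps_seti; exact: mem_head.
have [T2 [s3 [e3 le3 q3]]] := IH j.+1 (seti s2 i 0 j.+1) ltac:(lia) K3
   ltac:(by rewrite /= /upd !eqxx) I2.
exists (bcost (BNot (BILe e (V i))) + (T1 + 6) + T2).+1, s3; split=> //.
  apply: (ExecWhileTrue _ (s2 := seti s2 i 0 j.+1) _ e3).
    by rewrite /= eE // ij -ltnNge.
  apply: (ExecSeq e1).
  have -> : seti s2 i 0 j.+1 =
      seti s2 i (ieval s2 (INat 0)) (ieval s2 (IAdd (V i) (INat 1))).
    by rewrite /= i2 ij addn1.
  exact: (ExecISet i (INat 0) (IAdd (V i) (INat 1)) s2).
by rewrite /= mulSn; lia.
Qed.

End TimedHoare.

Arguments keepsI {R A B s s'} _ a%_N _.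
Arguments keepsR {R A B s s'} _ a%_N _.

(** * The program *)

(* Integer banks: 3 holds k, 4 the word length L, 5 the number of words, 6 the
   radius of every ball, 7 the current word, 8 the points selected so far, 9 a
   flag telling that a solution has been recorded, 10 to 16 loop variables (12
   a ball, 16 a point), 17 the running argmax, 18 the carry.  Real banks: 3
   holds the current centers, 4 to 6 are scalars. *)
Definition dimE := IGet 0 (INat 1).

Definition cellE b := IAdd (IMul b dimE) (V 15).

Definition dist_cmd :=
  Seq (SetR 4 (ROfNat (INat 0)))
    (For 15 dimE
       (SetR 4
          (let x := RSub (RGet 0 (cellE (V 16))) (RGet 3 (cellE (V 12))) in
           RAdd (RV 4) (RMul x x)))).

Definition row_cmd e := For 15 dimE (RSet 3 (cellE (V 12)) e).

Definition far_cmd :=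
  Seq (SetR 5 (RSub (ROfNat (INat 0)) (ROfNat (INat 1))))
  (Seq (SetV 17 (INat 0))
    (For 14 (V 11)
      (If (BAnd (BILe (IGet 7 (V 14)) (V 12)) (BILe (V 12) (IGet 7 (V 14))))
        (Seq (SetV 16 (IGet 8 (V 14)))
        (Seq dist_cmd
          (If (BRLe (RV 4) (RV 5)) Skip
            (Seq (SetR 5 (RV 4)) (SetV 17 (V 16))))))
        Skip))).

Definition bc_cmd :=
  Seq far_cmd
    (row_cmd (RDiv (RAdd (RMul (ROfNat (V 13)) (RGet 3 (cellE (V 12))))
                         (RGet 0 (cellE (V 17))))
                   (ROfNat (IAdd (V 13) (INat 1))))).

Definition centers_cmd N :=
  For 12 (V 3) (Seq (row_cmd (ROfNat (INat 0))) (For 13 (INat N) bc_cmd)).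

Definition cover_cmd :=
  Seq (SetR 6 (ROfNat (INat 0)))
    (For 12 (V 3)
      (Seq dist_cmd
      (Seq (SetR 4 (RDiv (RV 4)
                     (ROfNat (IMul (IGet 6 (V 12)) (IGet 6 (V 12))))))
        (If (BAnd (BNot (BILe (V 12) (INat 0))) (BNot (BRLe (RV 4) (RV 6))))
          Skip (SetR 6 (RV 4)))))).

Definition worst_cmd :=
  Seq (SetR 5 (RSub (ROfNat (INat 0)) (ROfNat (INat 1))))
  (Seq (SetV 17 (INat 0))
    (For 16 (IGet 0 (INat 0))
      (Seq cover_cmd
        (If (BRLe (RV 6) (RV 5)) Skip
          (Seq (SetR 5 (RV 6)) (SetV 17 (V 16))))))).

(** The flag in bank 9 stands in for an infinite initial dilation. *)
Definition record_cmd :=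
  If (BAnd (BILe (INat 1) (V 9)) (BRLe (RV 1) (RSqrt (RV 5)))) Skip
    (Seq (SetV 9 (INat 1))
    (Seq (SetR 1 (RSqrt (RV 5)))
      (For 15 (IMul (V 3) dimE) (RSet 2 (V 15) (RGet 3 (V 15)))))).

(** The centers are recomputed from the history alone, which has at most k M entries, so [worst_cmd]
    is the only part whose cost depends on n. *)
Definition step_cmd N :=
  Seq (centers_cmd N)
  (Seq worst_cmd
  (Seq record_cmd
    (ISet 8 (V 11) (V 17)))).

Definition next_word_cmd :=
  Seq (SetV 18 (INat 1))
    (For 14 (V 4)
      (Seq (ISet 7 (V 14) (IAdd (IGet 7 (V 14)) (V 18)))
        (If (BILe (V 3) (IGet 7 (V 14)))
          (Seq (ISet 7 (V 14) (INat 0)) (SetV 18 (INat 1)))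
          (SetV 18 (INat 0))))).

Definition search_cmd N :=
  For 10 (V 5) (Seq (For 11 (V 4) (step_cmd N)) next_word_cmd).

Definition setup_cmd M :=
  Seq (For 14 (IGet 0 (INat 2))
         (For 15 (IGet 2 (V 14))
            (Seq (ISet 6 (V 3) (IGet 1 (V 14)))
                 (SetV 3 (IAdd (V 3) (INat 1))))))
  (Seq (SetV 4 (IMul (V 3) (INat M)))
  (Seq (SetV 5 (INat 1))
       (For 14 (V 4) (SetV 5 (IMul (V 5) (V 3)))))).

Definition nukc_prog M := Seq (setup_cmd M) (search_cmd (M * M)).

(** * Correctness and cost of the geometric subroutines *)

Section Distances.
Variables (R : realType) (d : nat).
Implicit Types (s : state R).

Definition vec s a p : 'rV[R]_d := \row_(l < d) rmem s a (p * d + l)%N.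

Lemma cell_eq b b' l l' : (l < d)%N -> (l' < d)%N ->
  ((b' * d + l' == b * d + l) = (b' == b) && (l' == l))%N.
Proof.
move=> ld l'd; apply/eqP/andP => [E|[/eqP-> /eqP->]] //.
have d0 : (0 < d)%N by apply: leq_ltn_trans ld.
have := congr1 (divn^~ d) E; rewrite !divnMDl // !divn_small // !addn0 => bb.
by move: E; rewrite bb eqxx => /addnI ->.
Qed.

Lemma upd_same T (m : nat -> nat -> T) a i v : upd m a i v a i = v.
Proof. by rewrite /upd !eqxx. Qed.

Lemma wp_dist s : imem s 0 1 = d ->
  wp dist_cmd s (d * 60 + 60) (fun s' => keeps [:: 15%N] [:: 4%N] s s' /\
    rmem s' 4 0 = sqd (vec s 0 (imem s 16 0)) (vec s 3 (imem s 12 0))).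
Proof.
move=> dE; pose F l := (rmem s 0 (imem s 16 0 * d + l)%N -
                        rmem s 3 (imem s 12 0 * d + l)%N) ^+ 2.
pose s0 := setr s 4 0 0.
have K0 : keeps [:: 15%N] [:: 4%N] s s0 by apply: keeps_setr.
eapply wp_le.
  apply: (@wp_seq _ _ _ _ _ _ (eq^~ s0)); first exact: wp_rset.
  move=> _ ->; eapply wp_post.
  apply: (@wp_for _ _ _ _ [::] [:: 4%N]
    (fun j s1 => rmem s1 4 0 = \sum_(0 <= l < j) F l) _ d) => //.
  - by move=> s1 K /=; rewrite (keepsI K 0 isT).
  - by rewrite big_nil.
  - move=> j s1 jd K jE Ij; apply: wp_rset; split.
      exact: keeps_setr.
    rewrite /= upd_same big_nat_recr //= -Ij; congr (_ + _).
    rewrite !(keepsI K 16 isT, keepsI K 12 isT, keepsI K 0 isT).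
    by rewrite !(keepsR K 0 isT, keepsR K 3 isT) jE dE.
  - move=> s1 [K Ij]; split; first by apply: keeps_trans K0 _.
    rewrite Ij /sqd big_mkord; apply: eq_bigr => l _; rewrite !mxE //.
by rewrite /=; lia.
Qed.

End Distances.

Section Rows.
Variables (R : realType) (d : nat).
Implicit Types (s : state R) (f : nat -> R).
Local Notation vec := (@vec R d).

Lemma vec_keeps A B s s' a p : keeps A B s s' -> a \notin B ->
  vec s' a p = vec s a p.
Proof. by move=> K aB; apply/rowP => l; rewrite !mxE (keepsR K). Qed.

(** The expression may read the cell about to be overwritten, as in the in-place update of a center:
    coordinate [l] is untouched until its own turn. *)
Lemma wp_row e f s : imem s 0 1 = d ->
  (forall s1 l, (l < d)%N -> keeps [:: 15%N] [:: 3%N] s s1 ->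
     imem s1 15 0 = l ->
     rmem s1 3 (imem s 12 0 * d + l)%N = rmem s 3 (imem s 12 0 * d + l)%N ->
     reval s1 e = f l) ->
  wp (row_cmd e) s (d * (rcost e + 40) + 40) (fun s' =>
    [/\ keeps [:: 15%N] [:: 3%N] s s',
        vec s' 3 (imem s 12 0) = \row_(l < d) f l &
        forall b', b' != imem s 12 0 -> vec s' 3 b' = vec s 3 b']).
Proof.
set b := imem s 12 0; move=> dE eE.
eapply wp_le.
  eapply wp_post.
    apply: (@wp_for _ _ _ _ [::] [:: 3%N] (fun j s1 => forall b' l', (l' < d)%N ->
      rmem s1 3 (b' * d + l')%N =
      if (b' == b) && (l' < j)%N then f l' else rmem s 3 (b' * d + l')%N) _ d) => //.
    - by move=> s1 K /=; rewrite (keepsI K 0 isT).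
    - by move=> b' l' _; rewrite andbF.
    - move=> j s1 jd K jE Ij; apply: wp_rset; split; first exact: keeps_setr.
      move=> b' l' l'd; rewrite /= !(keepsI K 12 isT, keepsI K 0 isT) jE dE -/b.
      rewrite /upd eqxx cell_eq //= ltnS Ij //.
      case: eqP => [->|] //=; case: (ltngtP l' j) => //= ->.
      by apply: eE => //; rewrite Ij // eqxx ltnn.
  move=> s1 [K Ij]; split=> // [|b' b'b]; apply/rowP => l; rewrite !mxE Ij //.
    by rewrite eqxx ltn_ord.
  by rewrite (negbTE b'b).
by rewrite /=; lia.
Qed.

End Rows.
Arguments vec_keeps {R d A B s s' a p} _ _.

Section FarthestAssigned.
Variables (R : realType) (d : nat) (P : nat -> 'rV[R]_d).
Implicit Types (s : state R) (f : nat -> R).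
Local Notation vec := (@vec R d).

(** Bank 7 holds the whole word from the start, and only its first [size H] letters belong to the
    history. The loop counter in bank 11 serves as the length. *)
Definition codes (H : seq (nat * nat)) s :=
  imem s 11 0 = size H /\
  forall h, (h < size H)%N -> imem s 8 h = (nth (0, 0)%N H h).1 /\
                              imem s 7 h = (nth (0, 0)%N H h).2.

Lemma codes_keeps A B H s s' : keeps A B s s' ->
  [&& 7 \notin A, 8 \notin A & 11 \notin A] -> codes H s -> codes H s'.
Proof.
move=> K /and3P[k7 k8 k11] [c1 c2].
by rewrite /codes (keepsI K 7 k7) (keepsI K 8 k8) (keepsI K 11 k11).
Qed.

Lemma take_step (H : seq (nat * nat)) j b : (j < size H)%N ->
  assigned (take j.+1 H) b =
  if (nth (0, 0)%N H j).2 == b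
  then rcons (assigned (take j H) b) (nth (0, 0)%N H j).1
  else assigned (take j H) b.
Proof.
by move=> jH; rewrite (take_nth (0, 0)%N) // assigned_rcons.
Qed.

Lemma wp_far H s : imem s 0 1 = d -> (forall p, vec s 0 p = P p) -> codes H s ->
  wp far_cmd s (size H * (d * 60 + 120) + 60) (fun s' =>
    keeps [:: 14; 15; 16; 17]%N [:: 4; 5]%N s s' /\
    imem s' 17 0 = (amax (fun q => sqd (P q) (vec s 3 (imem s 12 0)))
                      (assigned H (imem s 12 0))).2).
Proof.
set b := imem s 12 0; move=> dE PE [HE Hh].
pose a j := amax (fun q => sqd (P q) (vec s 3 b)) (assigned (take j H) b).
pose s0 := setr s 5 0 (-1); pose s1 := seti s0 17 0 0.
have K1 : keeps [:: 14; 15; 16; 17]%N [:: 4; 5]%N s s1.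
  by apply: (@keeps_trans _ _ _ _ s0); [exact: keeps_setr|exact: keeps_seti].
eapply wp_le.
  apply: (@wp_seq _ _ _ _ _ _ (eq^~ s0)).
    by apply: wp_rset; rewrite /= sub0r.
  move=> _ ->; apply: (@wp_seq _ _ _ _ _ _ (eq^~ s1)); first exact: wp_iset.
  move=> _ ->; eapply wp_post.
    apply: (@wp_for _ _ _ _ [:: 15; 16; 17]%N [:: 4; 5]%N
      (fun j s2 => rmem s2 5 0 = (a j).1 /\ imem s2 17 0 = (a j).2) _ (size H)) => //.
    - by move=> s2 K /=; rewrite (keepsI K 11 isT).
    - by rewrite /a take0.
    - move=> j s2 jH K jE [a1 a2].
      have [p8 p7] := Hh j jH.
      have b12 : imem s2 12 0 = b by rewrite (keepsI K 12 isT).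
      have [c8 c7] : imem s2 8 j = imem s 8 j /\ imem s2 7 j = imem s 7 j.
        by rewrite (keepsI K 8 isT) (keepsI K 7 isT).
      apply: wp_if => /=; rewrite jE b12 c7 p7 -eqn_leq => bE; last first.
        apply: wp_skip; split; first exact: keeps_refl.
        by rewrite /= /a take_step // (negbTE bE).
      pose s3 := seti s2 16 0 (nth (0, 0)%N H j).1.
      have K3 : keeps [:: 15; 16; 17]%N [:: 4; 5]%N s2 s3 by exact: keeps_seti.
      apply: (@wp_seq _ _ _ _ _ _ (eq^~ s3)).
        by apply: wp_iset; rewrite /= jE c8 p8.
      move=> _ ->; eapply wp_seq.
        by apply: (@wp_dist _ d); rewrite /= /upd /= (keepsI K 0 isT).
      move=> s4 [Kd D4].
      have K4 : keeps [:: 15; 16; 17]%N [:: 4; 5]%N s2 s4.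
        by apply: (keeps_trans K3); apply: keeps_sub Kd.
      have {}D4 : rmem s4 4 0 = sqd (P (nth (0, 0)%N H j).1) (vec s 3 b).
        rewrite D4 (keepsI K3 12 isT) b12 /= upd_same -PE.
        by rewrite !(vec_keeps K3) // !(vec_keeps K).
      have r5 : rmem s4 5 0 = (a j).1 by rewrite (keepsR Kd 5 isT).
      have i17 : imem s4 17 0 = (a j).2 by rewrite (keepsI Kd 17 isT).
      have i16 : imem s4 16 0 = (nth (0, 0)%N H j).1.
        by rewrite (keepsI Kd 16 isT) /= upd_same.
      have aE : a j.+1 = amax_step (fun q => sqd (P q) (vec s 3 b)) (a j)
                  (nth (0, 0)%N H j).1.
        by rewrite /a take_step // bE /amax foldl_rcons.
      apply: wp_if => /=; rewrite D4 r5 => cE.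
        by apply: wp_skip; split=> //=; rewrite aE /amax_step cE.
      apply: (@wp_seq _ _ _ _ _ _ (eq^~ (setr s4 5 0 (rmem s4 4 0)))).
        exact: wp_rset.
      move=> _ ->; apply: wp_iset; split.
        apply: (keeps_trans K4).
        apply: (@keeps_trans _ _ _ _ (setr s4 5 0 (rmem s4 4 0))).
          exact: keeps_setr.
        exact: keeps_seti.
      by rewrite /= !upd_same aE /amax_step (negbTE cE) D4 i16.
  move=> s5 [K5 [_ ->]]; split; first by apply: keeps_trans K1 _.
  by rewrite /a take_size.
by rewrite /=; lia.
Qed.

End FarthestAssigned.

Section Centers.
Variables (R : realType) (d : nat) (P : nat -> 'rV[R]_d).
Implicit Types (s : state R) (f : nat -> R).
Local Notation vec := (@vec R d).

Lemma wp_bc H s : imem s 0 1 = d -> (forall p, vec s 0 p = P p) -> codes H s ->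
  wp bc_cmd s (size H * (d * 60 + 120) + d * 70 + 120) (fun s' =>
    [/\ keeps [:: 14; 15; 16; 17]%N [:: 3; 4; 5]%N s s',
        vec s' 3 (imem s 12 0) =
          bc_step P H (imem s 12 0) (imem s 13 0) (vec s 3 (imem s 12 0)) &
        forall b, b != imem s 12 0 -> vec s' 3 b = vec s 3 b]).
Proof.
set b := imem s 12 0; set i := imem s 13 0; move=> dE PE Hs.
eapply wp_le.
  eapply wp_seq; first exact: (wp_far dE PE Hs).
  move=> s1 [K1 q1]; set q := (amax _ _).2 in q1.
  eapply wp_post.
    apply: (@wp_row _ d _ (fun l =>
      (i%:R * rmem s 3 (b * d + l)%N + rmem s 0 (q * d + l)%N) / (i + 1)%:R)).
      by rewrite (keepsI K1 0 isT).
    move=> s2 l ld K2 lE; rewrite (keepsI K1 12 isT) -/b => c3 /=.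
    rewrite (keepsI K2 13 isT) (keepsI K1 13 isT) (keepsI K2 12 isT).
    rewrite (keepsI K1 12 isT) (keepsI K2 17 isT) q1 (keepsI K2 0 isT).
    rewrite (keepsI K1 0 isT) dE lE c3 (keepsR K1 3 isT) (keepsR K2 0 isT).
    by rewrite (keepsR K1 0 isT).
  move=> s2 [K2]; rewrite (keepsI K1 12 isT) -/b => row2 other2; split.
  - by apply: (@keeps_trans _ _ _ _ s1); [apply: keeps_sub K1|apply: keeps_sub K2].
  - rewrite row2; apply/rowP => l; rewrite !mxE -PE !mxE /= addn1.
    by rewrite mulrC.
  - by move=> b' bb; rewrite other2 // (vec_keeps K1).
by rewrite /=; lia.
Qed.

Lemma wp_centers H k N s : imem s 0 1 = d -> (forall p, vec s 0 p = P p) ->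
  codes H s -> imem s 3 0 = k ->
  wp (centers_cmd N) s
    (k * (N * (size H * (d * 60 + 120) + d * 70 + 140) + d * 50 + 100) + 20)
    (fun s' => keeps [:: 12; 13; 14; 15; 16; 17]%N [:: 3; 4; 5]%N s s' /\
       forall b, (b < k)%N -> vec s' 3 b = bc P H b N).
Proof.
move=> dE PE Hs kE; eapply wp_le.
  eapply wp_post.
    apply: (@wp_for _ _ _ _ [:: 13; 14; 15; 16; 17]%N [:: 3; 4; 5]%N
      (fun j s1 => forall b, (b < j)%N -> vec s1 3 b = bc P H b N) _ k) => //.
    - by move=> s1 K /=; rewrite (keepsI K 3 isT).
    - move=> b s1 bk K bE Ib.
      have d1 : imem s1 0 1 = d by rewrite (keepsI K 0 isT).
      eapply wp_seq.
        by apply: (@wp_row _ d _ (fun=> 0)) => // s2 l _ _ _ _.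
      move=> s2 [K2]; rewrite bE => row2 other2.
      eapply wp_post.
        apply: (@wp_for _ _ _ _ [:: 14; 15; 16; 17]%N [:: 3; 4; 5]%N
          (fun i s3 => vec s3 3 b = bc P H b i /\
             forall b', b' != b -> vec s3 3 b' = vec s1 3 b') _ N) => //.
        - by rewrite /= {1}/vec /= -/(vec s2 3 b) row2; split=> //;
            apply/rowP => l; rewrite !mxE.
        - move=> i s3 iN K3 iE [I3 O3].
          have K13 : keeps [:: 12; 13; 14; 15; 16; 17]%N [:: 3; 4; 5]%N s s3.
            apply: (@keeps_trans _ _ _ _ s1).
              exact: keeps_sub K.
            apply: (@keeps_trans _ _ _ _ s2); first exact: keeps_sub K2.
            exact: keeps_sub K3.
          have b3 : imem s3 12 0 = b.
            by rewrite (keepsI K3 12 isT) (keepsI K2 12 isT).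
          eapply wp_post.
            apply: (wp_bc _ _ (codes_keeps K13 isT Hs)).
              by rewrite (keepsI K13 0 isT).
            by move=> p; rewrite (vec_keeps K13).
          move=> s4 []; rewrite b3 iE => K4 row4 other4; split=> //; split.
            by rewrite -[LHS]/(vec s4 3 b) row4 I3.
          by move=> b' b'b; rewrite -[LHS]/(vec s4 3 b') other4 // O3.
      move=> s3 [K3 [I3 O3]]; split.
        apply: (@keeps_trans _ _ _ _ s2); first exact: keeps_sub K2.
        exact: keeps_sub K3.
      move=> b'; rewrite ltnS leq_eqVlt => /orP[/eqP->//|b'b].
      by rewrite -[LHS]/(vec s3 3 b') O3 ?Ib // ltn_eqF.
  by move=> s1 [K1 ?]; split.
by rewrite /=; lia.
Qed.

End Centers.

Lemma eq_rmin (R : realType) (f g : nat -> R) m :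
  (forall b, (b < m)%N -> f b = g b) -> rmin f m = rmin g m.
Proof.
elim: m => //= m IH fg; rewrite fg // IH // => b bm.
by apply: fg; exact: ltnW.
Qed.

(** * Evaluation and recording of a candidate solution *)

Section Evaluation.
Variables (R : realType) (d n k : nat) (P : nat -> 'rV[R]_d).
Variable rad : nat -> nat.
Implicit Types (s : state R) (f : nat -> R).
Local Notation vec := (@vec R d).

(** The points are prescribed at every index, also beyond n: [P] will be read off the initial
    memory, and real bank 0 is never written. *)
Definition static s :=
  [/\ imem s 0 0 = n, imem s 0 1 = d, imem s 3 0 = k,
      forall b, (b < k)%N -> imem s 6 b = rad b & forall p, vec s 0 p = P p].

Lemma static_keeps A B s s' : keeps A B s s' ->
  [&& 0 \notin A, 3 \notin A, 6 \notin A & 0 \notin B] -> static s -> static s'.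
Proof.
move=> K /and4P[k0 k3 k6 r0] [S1 S2 S3 S4 S5].
split; rewrite ?(keepsI K 0 k0) ?(keepsI K 3 k3) ?(keepsI K 6 k6) // => p.
by rewrite (vec_keeps K).
Qed.

Lemma wp_cover s : static s ->
  wp cover_cmd s (k * (d * 60 + 150) + 30) (fun s' =>
    keeps [:: 12; 15]%N [:: 4; 6]%N s s' /\
    rmem s' 6 0 = rmin (scaled_sqd P rad (vec s 3) (imem s 16 0)) k).
Proof.
move=> St; have [_ dE kE radE PE] := St.
set p := imem s 16 0; pose s0 := setr s 6 0 0.
have K0 : keeps [:: 12; 15]%N [:: 4; 6]%N s s0 by exact: keeps_setr.
eapply wp_le.
  apply: (@wp_seq _ _ _ _ _ _ (eq^~ s0)); first exact: wp_rset.
  move=> _ ->; eapply wp_post.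
    apply: (@wp_for _ _ _ _ [:: 15]%N [:: 4; 6]%N
      (fun b s1 => rmem s1 6 0 = rmin (scaled_sqd P rad (vec s 3) p) b) _ k) => //.
    - by move=> s1 K /=; rewrite (keepsI K 3 isT).
    - move=> b s1 bk K bE Ib.
      eapply wp_seq.
        by apply: (@wp_dist _ d); rewrite (keepsI K 0 isT).
      move=> s2 [K2]; rewrite bE (keepsI K 16 isT) (vec_keeps K) //.
      rewrite (vec_keeps K) // -[imem s0 16 0]/p => D2.
      pose s3 := setr s2 4 0 (scaled_sqd P rad (vec s 3) p b).
      apply: (@wp_seq _ _ _ _ _ _ (eq^~ s3)).
        apply: wp_rset; rewrite /s3 /scaled_sqd /= D2 (keepsI K2 12 isT) bE.
        by rewrite (keepsI K2 6 isT) (keepsI K 6 isT) /= radE // -PE.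
      move=> _ ->.
      have K3 : keeps [:: 15]%N [:: 4; 6]%N s1 s3.
        apply: (@keeps_trans _ _ _ _ s2); first exact: keeps_sub K2.
        exact: keeps_setr.
      have i12 : imem s2 12 0 = b by rewrite (keepsI K2 12 isT).
      have r6 : rmem s2 6 0 = rmin (scaled_sqd P rad (vec s 3) p) b.
        by rewrite (keepsR K2 6 isT).
      apply: wp_if => /=.
        rewrite i12 upd_same {1}/upd /= r6 leqn0 => /andP[/negbTE b0 /negbTE c].
        by apply: wp_skip; split=> //=; rewrite /upd /= b0 c.
      rewrite i12 upd_same {1}/upd /= r6 leqn0 -negb_or negbK => c.
      apply: wp_rset; split.
        by apply: (keeps_trans K3); exact: keeps_setr.
      by rewrite /= !upd_same c.
  by move=> s1 [K1 I1]; split=> //; apply: keeps_trans K0 _.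
by rewrite /=; lia.
Qed.

Lemma wp_worst (c : nat -> 'rV[R]_d) s : static s ->
  (forall b, (b < k)%N -> vec s 3 b = c b) ->
  wp worst_cmd s (n * (k * (d * 60 + 150) + 80) + 40) (fun s' =>
    keeps [:: 12; 15; 16; 17]%N [:: 4; 5; 6]%N s s' /\
    (rmem s' 5 0, imem s' 17 0) =
      amax (fun p => rmin (scaled_sqd P rad c p) k) (iota 0 n)).
Proof.
move=> St cE.
pose f p := rmin (scaled_sqd P rad c p) k.
pose a j := amax f (iota 0 j).
pose s0 := setr s 5 0 (-1); pose s1 := seti s0 17 0 0.
have K1 : keeps [:: 12; 15; 16; 17]%N [:: 4; 5; 6]%N s s1.
  by apply: (@keeps_trans _ _ _ _ s0); [exact: keeps_setr|exact: keeps_seti].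
eapply wp_le.
  apply: (@wp_seq _ _ _ _ _ _ (eq^~ s0)).
    by apply: wp_rset; rewrite /= sub0r.
  move=> _ ->; apply: (@wp_seq _ _ _ _ _ _ (eq^~ s1)); first exact: wp_iset.
  move=> _ ->; eapply wp_post.
    apply: (@wp_for _ _ _ _ [:: 12; 15; 17]%N [:: 4; 5; 6]%N
      (fun j s2 => rmem s2 5 0 = (a j).1 /\ imem s2 17 0 = (a j).2) _ n) => //.
    - by move=> s2 K /=; rewrite (keepsI K 0 isT); case: St.
    - move=> j s2 jn K jE [a1 a2].
      have K2 : keeps [:: 12; 15; 16; 17]%N [:: 4; 5; 6]%N s s2.
        by apply: (keeps_trans K1); apply: keeps_sub K.
      eapply wp_seq; first exact: (wp_cover (static_keeps K2 isT St)).
      move=> s3 [K3]; rewrite jE => m3.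
      have {}m3 : rmem s3 6 0 = f j.
        rewrite m3; apply: eq_rmin => b bk; rewrite /scaled_sqd (vec_keeps K2) //.
        by rewrite cE.
      have r5 : rmem s3 5 0 = (a j).1 by rewrite (keepsR K3 5 isT).
      have i17 : imem s3 17 0 = (a j).2 by rewrite (keepsI K3 17 isT).
      have i16 : imem s3 16 0 = j by rewrite (keepsI K3 16 isT).
      have K23 : keeps [:: 12; 15; 17]%N [:: 4; 5; 6]%N s2 s3.
        exact: keeps_sub K3.
      have aE : a j.+1 = amax_step f (a j) j.
        by rewrite /a -addn1 iotaD /amax foldl_cat.
      apply: wp_if => /=; rewrite m3 r5 => c3.
        by apply: wp_skip; split=> //=; rewrite aE /amax_step c3.
      apply: (@wp_seq _ _ _ _ _ _ (eq^~ (setr s3 5 0 (rmem s3 6 0)))).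
        exact: wp_rset.
      move=> _ ->; apply: wp_iset; split.
        apply: (keeps_trans K23).
        apply: (@keeps_trans _ _ _ _ (setr s3 5 0 (rmem s3 6 0))).
          exact: keeps_setr.
        exact: keeps_seti.
      by rewrite /= !upd_same aE /amax_step (negbTE c3) m3 i16.
  move=> s5 [K5 [-> ->]]; split.
    by apply: (keeps_trans K1); apply: keeps_sub K5.
  by rewrite -surjective_pairing.
by rewrite /=; lia.
Qed.

Lemma wp_record s : static s ->
  wp record_cmd s (k * d * 30 + 60) (fun s' =>
    [/\ keeps [:: 9; 15]%N [:: 1; 2]%N s s',
        (0 < imem s' 9 0)%N,
        rmem s' 1 0 <= Num.sqrt (rmem s 5 0) /\
          ((0 < imem s 9 0)%N -> rmem s' 1 0 <= rmem s 1 0) &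
        (s' = s \/ (rmem s' 1 0 = Num.sqrt (rmem s 5 0) /\
          forall b, (b < k)%N -> vec s' 2 b = vec s 3 b))]).
Proof.
move=> St; have [_ dE kE _ _] := St.
set v := Num.sqrt _.
eapply wp_le.
  apply: wp_if => /=.
    move=> /andP[h b]; apply: wp_skip; split=> //; by left.
  rewrite negb_and -ltnNge -ltNge -/v => c.
  pose s1 := seti s 9 0 1; pose s2 := setr s1 1 0 v.
  have K2 : keeps [:: 9; 15]%N [:: 1; 2]%N s s2.
    by apply: (@keeps_trans _ _ _ _ s1); [exact: keeps_seti|exact: keeps_setr].
  apply: (@wp_seq _ _ _ _ _ _ (eq^~ s1)); first exact: wp_iset.
  move=> _ ->.
  apply: (@wp_seq _ _ _ _ _ _ (eq^~ s2)); first exact: wp_rset.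
  move=> _ ->; eapply wp_post.
    apply: (@wp_for _ _ _ _ [::]%N [:: 2]%N
      (fun j s3 => forall x, (x < j)%N -> rmem s3 2 x = rmem s 3 x) _ (k * d)%N) => //.
    - by move=> s3 K /=; rewrite (keepsI K 3 isT) (keepsI K 0 isT)
         (keepsI K2 3 isT) (keepsI K2 0 isT) kE dE.
    - move=> x s3 xk K xE Ix; apply: wp_rset; split; first exact: keeps_setr.
      move=> x'; rewrite /= xE (keepsR K 3 isT) /= ltnS leq_eqVlt /upd eqxx /=.
      by case: eqP => [->//|_] /=; exact: Ix.
  move=> s3 [K3 I3].
  have r1 : rmem s3 1 0 = v by rewrite (keepsR K3 1 isT) /= upd_same.
  split.
  - by apply: (keeps_trans K2); apply: keeps_sub K3.
  - by rewrite (keepsI K3 9 isT) /= upd_same.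
  - split; first by rewrite r1.
    by move=> h; rewrite r1; case/orP: c => [c|/ltW//]; lia.
  - right; split=> // b bk; apply/rowP => l; rewrite !mxE I3 //.
    have : (b * d + l < b.+1 * d)%N by rewrite mulSn addnC ltn_add2r.
    by move=> h; apply: (leq_trans h); rewrite leq_mul2r bk orbT.
by rewrite /=; lia.
Qed.

End Evaluation.

(** * Enumeration of the words as numbers in base k *)

Definition digit k v h := (v %/ k ^ h %% k)%N.

Lemma digit_exists k L (w : nat -> nat) : (0 < k)%N -> (forall h, (w h < k)%N) ->
  exists2 v, (v < k ^ L)%N & forall h, (h < L)%N -> digit k v h = w h.
Proof.
move=> k0; elim: L w => [|L IH] w wk; first by exists 0%N.
have [v vL vE] := IH (fun h => w h.+1) (fun h => wk h.+1).
exists (v * k + w 0)%N.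
  rewrite expnSr; apply: leq_trans (_ : v.+1 * k <= _)%N.
    by rewrite mulSn addnC ltn_add2r.
  by rewrite leq_mul2r vL orbT.
move=> [_|h hL]; first by rewrite /digit divn1 modnMDl modn_small.
by rewrite /digit expnS divnMA divnMDl // (divn_small (wk 0)) addn0 -[RHS]vE.
Qed.

Section Words.
Variables (R : realType).
Implicit Types (s : state R).

(** The carry into position j is 1 iff the j lower digits of [v] all equal k - 1, that is, iff k^j
    divides v + 1. After the last word the counter wraps around. *)
Lemma wp_next_word k L v s : (0 < k)%N -> imem s 3 0 = k -> imem s 4 0 = L ->
  (forall h, (h < L)%N -> imem s 7 h = digit k v h) ->
  wp next_word_cmd s (L * 60 + 40) (fun s' =>
    keeps [:: 7; 14; 18]%N [::] s s' /\
    forall h, (h < L)%N -> imem s' 7 h = digit k v.+1 h).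
Proof.
move=> k0 kE LE wE; pose s0 := seti s 18 0 1.
have K0 : keeps [:: 7; 14; 18]%N [::] s s0 by exact: keeps_seti.
eapply wp_le.
  apply: (@wp_seq _ _ _ _ _ _ (eq^~ s0)); first exact: wp_iset.
  move=> _ ->; eapply wp_post.
    apply: (@wp_for _ _ _ _ [:: 7; 18]%N [::]
      (fun j s1 => (forall h, (h < L)%N ->
          imem s1 7 h = digit k (if (h < j)%N then v.+1 else v) h) /\
         imem s1 18 0 = (k ^ j %| v.+1)%N) _ L) => //.
    - by move=> s1 K /=; rewrite (keepsI K 4 isT).
    - split=> [h hL|]; first by rewrite -wE.
      by rewrite expn0 dvd1n.
    - move=> j s1 jL K jE [I1 I2].
      set c := (k ^ j %| v.+1)%N in I2; pose q := (v %/ k ^ j)%N.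
      have Ij : imem s1 7 j = (q %% k)%N by rewrite I1 // ltnn.
      have dE : digit k v.+1 j = ((c + q) %% k)%N.
        by rewrite /digit divnS ?expn_gt0 ?k0.
      have cE : (k ^ j.+1 %| v.+1)%N = c && (k %| q.+1)%N.
        case: (boolP c) => [|cN] /=; last first.
          by apply: contraNF cN; apply: dvdn_trans; rewrite expnS dvdn_mull.
        move=> cT; have qE : (v.+1 %/ k ^ j = q.+1)%N.
          by rewrite divnS ?expn_gt0 ?k0 // -/c cT.
        by rewrite -{1}(divnK cT) qE expnS dvdn_pmul2r // expn_gt0 k0.
      pose x := (q %% k + c)%N.
      pose s2 := seti s1 7 j x.
      have K2 : keeps [:: 7; 18]%N [::] s1 s2 by exact: keeps_seti.
      apply: (@wp_seq _ _ _ _ _ _ (eq^~ s2)).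
        by apply: wp_iset; rewrite /= jE Ij I2.
      move=> _ ->.
      have k2 : imem s2 3 0 = k by rewrite (keepsI K2 3 isT) (keepsI K 3 isT).
      have j2 : imem s2 14 0 = j by rewrite (keepsI K2 14 isT).
      have x2 : imem s2 7 j = x by rewrite /= upd_same.
      (* A carry leaves position j exactly if one enters and the digit is k - 1, that is, k divides
         q + 1; otherwise [x] is already the new digit. *)
      have [xc|xc] : ((c && (k %| q.+1) /\ (k <= x) /\ digit k v.+1 j = 0) \/
            (c && (k %| q.+1) = false /\ (x < k) /\ digit k v.+1 j = x))%N.
        rewrite dE /x; case: (c) => /=; last first.
          by right; rewrite addn0 add0n ltn_pmod.
        rewrite addn1 add1n modnS; case: (boolP (k %| q.+1)%N) => kq.
          left; split=> //; split=> //; rewrite leqNgt; apply/negP => lt.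
          by move: kq; rewrite /dvdn -addn1 -modnDml addn1 modn_small.
        right; split=> //; split=> //; rewrite ltn_neqAle ltn_pmod // andbT.
        apply: contra kq => /eqP E.
        by rewrite /dvdn -addn1 -modnDml addn1 E modnn.
      - case: xc => cT [kx d0].
        apply: wp_if;
          rewrite [beval _ _]/(imem s2 3 0 <= imem s2 7 (imem s2 14 0))%N !(k2, j2, x2).
          move=> _; pose s3 := seti s2 7 j 0.
          apply: (@wp_seq _ _ _ _ _ _ (eq^~ s3)).
            by apply: wp_iset; rewrite /= /upd /= jE.
          move=> _ ->; apply: wp_iset; split.
            apply: (keeps_trans K2); apply: (@keeps_trans _ _ _ _ s3).
              exact: keeps_seti.
            exact: keeps_seti.
          split; last by rewrite /= ?upd_same cE cT.
          move=> h hL; rewrite /= /upd /= ltnS leq_eqVlt.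
          by case: eqP => [->|_] /=; rewrite ?d0 // I1.
        by rewrite -/(leq k x) kx.
      - case: xc => cF [kx d0].
        apply: wp_if;
          rewrite [beval _ _]/(imem s2 3 0 <= imem s2 7 (imem s2 14 0))%N !(k2, j2, x2).
          by rewrite -/(leq k x) leqNgt kx.
        move=> _; apply: wp_iset; split.
          by apply: (keeps_trans K2); exact: keeps_seti.
        split; last by rewrite /= ?upd_same cE cF.
        move=> h hL; rewrite /= /upd /= ltnS leq_eqVlt.
        by case: eqP => [->|_] /=; rewrite ?d0 // I1.
  move=> s1 [K1 [I1 _]]; split; first by apply: (keeps_trans K0); apply: keeps_sub K1.
  by move=> h hL; rewrite I1 // hL.
by rewrite /=; lia.
Qed.
End Words.

(** * The search over all words *)

Section Step.
Variables (R : realType) (d n k N : nat) (P : nat -> 'rV[R]_d).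
Variable rad : nat -> nat.
Hypotheses (n_gt0 : (0 < n)%N) (k_gt0 : (0 < k)%N).
Hypothesis rad_gt0 : forall b, (b < k)%N -> (0 < rad b)%N.
Implicit Types (s : state R) (w : nat -> nat).
Local Notation vec := (@vec R d).
Local Notation static := (@static R d n k P rad).
Local Notation dil := (dil P n k N rad).
Local Notation hist := (hist P n k N rad).

Definition recorded s := 0 <= rmem s 1 0 /\
  forall p, (p < n)%N -> exists2 b, (b < k)%N &
    sqd (P p) (vec s 2 b) <= (rmem s 1 0 * (rad b)%:R) ^+ 2.

Definition best_le (a : R) s := (0 < imem s 9 0)%N /\ rmem s 1 0 <= a.

(** A transitive relation by which a bound on the recorded dilation, once reached, survives the rest
    of the search. *)
Definition improves s s' :=
  (0 < imem s 9 0)%N -> best_le (rmem s 1 0) s'.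

Lemma improves_trans s1 s2 s3 :
  improves s1 s2 -> improves s2 s3 -> improves s1 s3.
Proof.
move=> i12 i23 h1; have [h2 le12] := i12 h1; have [h3 le23] := i23 h2.
by split=> //; exact: le_trans le12.
Qed.

Lemma improves_best s s' a : improves s s' -> best_le a s -> best_le a s'.
Proof.
by move=> i [h sa]; have [h' s's] := i h; split=> //; exact: le_trans sa.
Qed.

Lemma improves_keeps A B s s' : keeps A B s s' -> 9 \notin A -> 1 \notin B ->
  improves s s'.
Proof.
by move=> K k9 k1 h; rewrite /best_le (keepsI K 9 k9) (keepsR K 1 k1).
Qed.

Lemma recorded_keeps A B s s' : keeps A B s s' -> 1 \notin B -> 2 \notin B ->
  recorded s -> recorded s'.
Proof.
move=> K k1 k2; rewrite /recorded (keepsR K 1 k1) => -[r0 rP]; split=> // p.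
by move=> /rP[b bk Hb]; exists b; rewrite // (vec_keeps K).
Qed.

Definition step_time L :=
  (k * (N * (L * (d * 60 + 120) + d * 70 + 140) + d * 50 + 100) +
   n * (k * (d * 60 + 150) + 80) + k * d * 30 + 200)%N.

Lemma wp_step L H s : (size H <= L)%N -> static s -> codes H s ->
  ((0 < imem s 9 0)%N -> recorded s) ->
  wp (step_cmd N) s (step_time L) (fun s' =>
    [/\ keeps [:: 8; 9; 12; 13; 14; 15; 16; 17]%N [:: 1; 2; 3; 4; 5; 6]%N s s',
        imem s' 8 (size H) = (worst P n k N rad H).2 /\
          (forall h, (h < size H)%N -> imem s' 8 h = imem s 8 h),
        recorded s', best_le (dil H) s' & improves s s']).
Proof.
move=> HL St Hs rec; have [_ dE kE _ PE] := St.
eapply wp_le.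
  eapply wp_seq.
    (* The budget in terms of [size H] is raised to one in terms of [L], since [wp_for] wants the
       same budget for all rounds. *)
    apply: (wp_le (wp_centers N dE PE Hs kE)).
    apply: (_ : _ <= k * (N * (L * (d * 60 + 120) + d * 70 + 140) +
                          d * 50 + 100) + 20)%N.
    rewrite leq_add2r leq_mul2l; apply/orP; right.
    rewrite !leq_add2r leq_mul2l; apply/orP; right.
    by rewrite !leq_add2r leq_mul2r HL orbT.
  move=> s1 [K1 cE]; have St1 := static_keeps K1 isT St.
  eapply wp_seq; first exact: (wp_worst St1 cE).
  move=> s2 [K2]; rewrite -/(worst P n k N rad H) => wE.
  have r5 : Num.sqrt (rmem s2 5 0) = dil H by rewrite /dil -wE.
  have i17 : imem s2 17 0 = (worst P n k N rad H).2 by rewrite -wE.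
  have K12 : keeps [:: 8; 9; 12; 13; 14; 15; 16; 17]%N [:: 1; 2; 3; 4; 5; 6]%N s s2.
    by apply: (@keeps_trans _ _ _ _ s1); [apply: keeps_sub K1|apply: keeps_sub K2].
  eapply wp_seq; first exact: (wp_record (static_keeps K12 isT St)).
  move=> s3 [K3 h3 [le3 im3] new3].
  have K13 : keeps [:: 8; 9; 12; 13; 14; 15; 16; 17]%N [:: 1; 2; 3; 4; 5; 6]%N s s3.
    by apply: (keeps_trans K12); apply: keeps_sub K3.
  have i39 : imem s2 9 = imem s 9 by rewrite (keepsI K2 9 isT) (keepsI K1 9 isT).
  have r31 : rmem s2 1 = rmem s 1 by rewrite (keepsR K2 1 isT) (keepsR K1 1 isT).
  apply: wp_iset => /=; rewrite (keepsI K3 11 isT) (keepsI K12 11 isT).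
  rewrite (keepsI K3 17 isT) i17; case: (Hs) => -> _; split.
  - by apply: (keeps_trans K13); exact: keeps_seti.
  - split; first by rewrite /= upd_same.
    by move=> h hH; rewrite /= /upd (ltn_eqF hH) andbF
      (keepsI K3 8 isT) (keepsI K2 8 isT) (keepsI K1 8 isT).
  - apply: (@recorded_keeps [:: 8%N] [::] s3) => //; first exact: keeps_seti.
    case: new3 => [s3E|[r1 v2]].
      rewrite s3E in h3 *; apply: (recorded_keeps K2) => //.
      by apply: (recorded_keeps K1) => //; apply: rec; rewrite -i39.
    rewrite /recorded r1 r5; split; first by rewrite sqrtr_ge0.
    move=> p pn; have [b bk Hb] := dil_covers P N n_gt0 k_gt0 rad_gt0 H pn.
    exists b => //; rewrite v2 // (vec_keeps K2) // cE //.
  - by split=> //=; rewrite -r5.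
  - by move=> h0; split=> //=; rewrite -r31; apply: im3; rewrite i39.
by rewrite /step_time /=; lia.
Qed.
End Step.

Section Search.
Variables (R : realType) (d n k N : nat) (P : nat -> 'rV[R]_d).
Variable rad : nat -> nat.
Hypotheses (n_gt0 : (0 < n)%N) (k_gt0 : (0 < k)%N).
Hypothesis rad_gt0 : forall b, (b < k)%N -> (0 < rad b)%N.
Implicit Types (s : state R) (w : nat -> nat).
Local Notation static := (@static R d n k P rad).
Local Notation dil := (dil P n k N rad).
Local Notation hist := (hist P n k N rad).
Local Notation recorded := (recorded n k P rad).
Local Notation step_time := (step_time d n k N).

(** Round j evaluates the history of length j before extending it, so L rounds cover the lengths 0
    to L - 1, the range in [exists_good_history]. Stale points in bank 8 do no harm, because the
    counter in bank 11 restarts the history as empty. *)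
Lemma wp_word L w s : static s -> imem s 4 0 = L ->
  (forall h, (h < L)%N -> imem s 7 h = w h) ->
  ((0 < imem s 9 0)%N -> recorded s) ->
  wp (For 11 (V 4) (step_cmd N)) s (L * (step_time L + 20) + 20) (fun s' =>
    [/\ keeps [:: 8; 9; 11; 12; 13; 14; 15; 16; 17]%N [:: 1; 2; 3; 4; 5; 6]%N s s',
        (0 < imem s' 9 0)%N -> recorded s',
        improves s s' &
        forall j, (j < L)%N -> best_le (dil (hist w j)) s']).
Proof.
move=> St LE wE rec; eapply wp_le.
  eapply wp_post.
    apply: (@wp_for _ _ _ _ [:: 8; 9; 12; 13; 14; 15; 16; 17]%N [:: 1; 2; 3; 4; 5; 6]%N
      (fun j s1 => [/\ codes (hist w j) s1, (0 < imem s1 9 0)%N -> recorded s1,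
        improves s s1 & forall i, (i < j)%N -> best_le (dil (hist w i)) s1]) _ L) => //.
    - by move=> s1 K /=; rewrite (keepsI K 4 isT).
    - move=> j s1 jL K jE [Ic Ir Ii Ib].
      eapply wp_post.
        apply: (@wp_step R d n k N P rad n_gt0 k_gt0 rad_gt0 L (hist w j)) => //.
          by rewrite size_hist ltnW.
        exact: static_keeps K isT St.
      move=> s2 [K2 [new old] r2 b2 i2]; split=> //; split.
      - split; first by rewrite size_hist /= upd_same.
        move=> h; rewrite size_hist ltnS /= nth_rcons size_hist.
        have k7 : imem s2 7 = imem s 7.
          by rewrite (keepsI K2 7 isT) (keepsI K 7 isT).
        case: Ic => _ Ic.
        rewrite leq_eqVlt => /predU1P[->|hj].
          rewrite ltnn eqxx /=; split; first by rewrite size_hist in new.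
          by rewrite -[LHS]/(imem s2 7 j) k7 wE.
        rewrite hj; have hs : (h < size (hist w j))%N by rewrite size_hist.
        have [<- <-] := Ic h hs; split; first exact: old.
        by rewrite -[LHS]/(imem s2 7 h) (keepsI K2 7 isT).
      - by move=> _.
      - exact: improves_trans Ii i2.
      - move=> i; rewrite ltnS leq_eqVlt => /predU1P[->//|/Ib ij].
        exact: improves_best i2 ij.
  by move=> s1 [K [_ ? ? ?]]; split=> //; apply: keeps_sub K.
by rewrite /=; lia.
Qed.

Lemma wp_search L K s : static s -> imem s 4 0 = L -> imem s 5 0 = K ->
  (forall h, (h < L)%N -> imem s 7 h = 0)%N -> imem s 9 0 = 0%N ->
  wp (search_cmd N) s (K * (L * (step_time L + 20) + L * 60 + 100) + 20) (fun s' =>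
    ((0 < imem s' 9 0)%N -> recorded s') /\
    forall v j, (v < K)%N -> (j < L)%N -> best_le (dil (hist (digit k v) j)) s').
Proof.
move=> St LE KE w0 f0; eapply wp_le.
  eapply wp_post.
    apply: (@wp_for _ _ _ _
      [:: 7; 8; 9; 11; 12; 13; 14; 15; 16; 17; 18]%N [:: 1; 2; 3; 4; 5; 6]%N
      (fun v s1 => [/\ forall h, (h < L)%N -> imem s1 7 h = digit k v h,
         (0 < imem s1 9 0)%N -> recorded s1 &
         forall v' j, (v' < v)%N -> (j < L)%N ->
           best_le (dil (hist (digit k v') j)) s1]) _ K) => //.
    - by move=> s1 K1 /=; rewrite (keepsI K1 5 isT).
    - split=> [h hL|f1|//].
        by rewrite -[LHS]/(imem s 7 h) w0 // /digit div0n mod0n.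
      by move: f1; rewrite -[imem _ 9 0]/(imem s 9 0) f0.
    - move=> v s1 vK K1 vE [Id Ir Ib].
      have St1 := static_keeps K1 isT St.
      have L1 : imem s1 4 0 = L by rewrite (keepsI K1 4 isT).
      eapply wp_seq; first exact: (wp_word St1 L1 Id Ir).
      move=> s2 [K2 r2 i2 b2].
      eapply wp_post.
        apply: (@wp_next_word _ k L v s2 k_gt0).
        - by have [_ _ + _ _] := St1; rewrite (keepsI K2 3 isT).
        - by rewrite (keepsI K2 4 isT).
        - by move=> h hL; rewrite (keepsI K2 7 isT) Id.
      move=> s3 [K3 d3]; split.
        by apply: (@keeps_trans _ _ _ _ s2); [apply: keeps_sub K2|apply: keeps_sub K3].
      have i3 : improves s2 s3 by apply: improves_keeps K3 _ _.
      split=> //.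
        move=> h; apply: (@recorded_keeps _ _ _ _ _ _ _ _ s2 _ K3) => //.
        by apply: r2; rewrite -(keepsI K3 9 isT).
      move=> v' j; rewrite ltnS leq_eqVlt => /predU1P[->|v'v] jL.
        by apply: (improves_best i3); apply: b2.
      by apply: (improves_best i3); apply: (improves_best i2); apply: Ib.
  by move=> s1 [_ [_ ? ?]]; split.
by rewrite /=; lia.
Qed.

End Search.

(** * Numbering of the balls *)

Section BallTypes.
Variable ml : nat -> nat.

Definition offset i := (\sum_(0 <= i' < i) ml i')%N.

Lemma offsetS i : offset i.+1 = (offset i + ml i)%N.
Proof. by rewrite /offset big_nat_recr. Qed.

Lemma leq_offset i j : (i <= j)%N -> (offset i <= offset j)%N.
Proof.
by move/subnKC <-; elim: (j - i)%N => [|m IH]; rewrite ?addn0 // addnS offsetS; lia.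
Qed.

(** It selects the last type below [t] whose offset is at most [x]; taking the last one skips types
    of multiplicity 0, which share their offset with the next type. *)
Fixpoint ball_type t x :=
  if t is t'.+1 then if (x < offset t')%N then ball_type t' x else t' else 0%N.

Lemma ball_typeP t x : (x < offset t)%N ->
  [/\ (ball_type t x < t)%N, (offset (ball_type t x) <= x)%N &
      (x < offset (ball_type t x) + ml (ball_type t x))%N].
Proof.
elim: t => [|t IH]; first by rewrite /offset big_geq.
rewrite /= offsetS; case: (ltnP x (offset t)) => [/IH[]|xt h]; last by split.
by split=> //; exact: ltnW.
Qed.

Lemma ball_typeE t i j : (i < t)%N -> (j < ml i)%N ->
  ball_type t (offset i + j) = i.
Proof.
elim: t => //= t IH; rewrite ltnS leq_eqVlt => /predU1P[->|it] jl.
  by rewrite ltnNge leq_addr.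
rewrite ifT ?IH //; apply: leq_trans (leq_offset it).
by rewrite offsetS ltn_add2l.
Qed.

End BallTypes.

Section Setup.
Variables (R : realType) (t M : nat) (br ml : nat -> nat).
Implicit Types (s : state R).
Local Notation k := (offset ml t).

(** The outer loop also visits types of multiplicity 0; [t <= k] keeps it within k rounds, and each
    inner loop is bounded crudely by k. *)
Lemma wp_setup s : imem s 0 2 = t -> imem s 3 0 = 0%N ->
  (forall i, (i < t)%N -> imem s 1 i = br i) ->
  (forall i, (i < t)%N -> imem s 2 i = ml i) -> (t <= k)%N ->
  wp (setup_cmd M) s (k * (k * 60 + 60) + k * M * 60 + 100) (fun s' =>
    [/\ keeps [:: 3; 4; 5; 6; 14; 15]%N [::] s s',
        imem s' 3 0 = k, imem s' 4 0 = (k * M)%N, imem s' 5 0 = (k ^ (k * M))%N &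
        forall b, (b < k)%N -> imem s' 6 b = br (ball_type ml t b)]).
Proof.
move=> tE k0 brE mlE tk.
have mlk i : (i < t)%N -> (ml i <= k)%N.
  move=> it; apply: leq_trans (leq_offset ml it); rewrite offsetS; exact: leq_addl.
eapply wp_le.
  eapply wp_seq.
    apply: (@wp_for _ _ _ _ [:: 3; 6; 15]%N [::]
      (fun i s1 => imem s1 3 0 = offset ml i /\
        forall b, (b < offset ml i)%N -> imem s1 6 b = br (ball_type ml t b)) _ t
      (k * 50 + 40)) => //.
    - by move=> s1 K /=; rewrite (keepsI K 0 isT).
    - by rewrite /offset big_geq.
    - move=> i s1 it K iE [I1 I2].
      eapply wp_le.
        eapply wp_post.
          apply: (@wp_for _ _ _ _ [:: 3; 6]%N [::]
            (fun j s2 => imem s2 3 0 = (offset ml i + j)%N /\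
              forall b, (b < offset ml i + j)%N -> imem s2 6 b = br (ball_type ml t b))
            _ (ml i)) => //.
          - by move=> s2 K2 /=; rewrite (keepsI K2 14 isT) iE
               (keepsI K2 2 isT) (keepsI K 2 isT) mlE.
          - by rewrite addn0.
          - move=> j s2 jl K2 jE [J1 J2].
            pose s3 := seti s2 6 (offset ml i + j) (br i).
            have K3 : keeps [:: 3; 6]%N [::] s2 s3 by exact: keeps_seti.
            apply: (@wp_seq _ _ _ _ _ _ (eq^~ s3)).
              apply: wp_iset; rewrite /= J1 (keepsI K2 14 isT) iE.
              by rewrite (keepsI K2 1 isT) (keepsI K 1 isT) brE.
            move=> _ ->; apply: wp_iset; split.
              by apply: (keeps_trans K3); exact: keeps_seti.
            have e3 : imem s3 3 0 = (offset ml i + j)%N by [].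
            split; first by rewrite addnS -e3 -[RHS]addn1.
            move=> b; rewrite addnS ltnS leq_eqVlt => /predU1P[->|bj].
              by rewrite /= /upd /= eqxx ball_typeE.
            by rewrite /= /upd /= (ltn_eqF bj) J2.
        move=> s2 [K2 [J1 J2]]; split; first by apply: keeps_sub K2.
        by rewrite offsetS.
      by have := mlk i it; rewrite /=; nia.
  move=> s1 [K1 [I1 I2]].
  pose s2 := seti s1 4 0 (k * M).
  have K2 : keeps [:: 3; 4; 5; 6; 14; 15]%N [::] s s2.
    by apply: (@keeps_trans _ _ _ _ s1); [apply: keeps_sub K1|exact: keeps_seti].
  pose s3 := seti s2 5 0 1.
  have K3 : keeps [:: 3; 4; 5; 6; 14; 15]%N [::] s s3.
    by apply: (keeps_trans K2); exact: keeps_seti.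
  apply: (@wp_seq _ _ _ _ _ _ (eq^~ s2)).
    by apply: wp_iset; rewrite /= I1.
  move=> _ ->; apply: (@wp_seq _ _ _ _ _ _ (eq^~ s3)); first exact: wp_iset.
  move=> _ ->; eapply wp_post.
    apply: (@wp_for _ _ _ _ [:: 5]%N [::]
      (fun i s4 => imem s4 5 0 = (k ^ i)%N) _ (k * M)%N) => //.
    - by move=> s4 K /=; rewrite (keepsI K 4 isT).
    - move=> i s4 ik K iE I4; apply: wp_iset; split; first exact: keeps_seti.
      have k4 : imem s4 3 0 = k by rewrite (keepsI K 3 isT).
      by rewrite expnSr -I4 -[in RHS]k4.
  move=> s4 [K4 I4]; split=> //.
  - by apply: (keeps_trans K3); apply: keeps_sub K4.
  - by rewrite (keepsI K4 3 isT).
  - by rewrite (keepsI K4 4 isT).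
  - by move=> b bk; rewrite (keepsI K4 6 isT) -[imem s3 6 b]/(imem s1 6 b) I2.
by rewrite /=; nia.
Qed.

End Setup.

(** * The instance *)

Lemma nth_allpairs (A B C : Type) (a : A) (b : B) (c : C) (f : A -> B -> C) s t i j :
  (i < size s)%N -> (j < size t)%N ->
  nth c [seq f x y | x <- s, y <- t] (i * size t + j) = f (nth a s i) (nth b t j).
Proof.
elim: s i => //= x s IH [|i] hi hj; rewrite nth_cat size_map.
  by rewrite mul0n add0n hj (nth_map b).
by rewrite mulSn -addnA ltnNge leq_addr addKn IH.
Qed.

Lemma hist_ext (R : realType) d (P : nat -> 'rV[R]_d) n k N rad w w' L j :
  (j <= L)%N -> (forall h, (h < L)%N -> w h = w' h) ->
  hist P n k N rad w j = hist P n k N rad w' j.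
Proof.
by move=> + ww; elim: j => //= j IH jL; rewrite IH ?ww // ltnW.
Qed.

Section Instance.
Variables (R : realType) (I : nukc R).
Local Notation n := (npts I).
Local Notation d := (ndim I).
Local Notation t := (ntypes I).
Local Notation k := (nballs I).
Local Notation s0 := (init_state I).

(** Reading the data off the initial memory gives total functions on [nat] and makes the input
    hypotheses of [wp_setup] hold by [erefl]. *)
Definition radii := imem s0 1.
Definition mults := imem s0 2.
Definition points p : 'rV[R]_d := vec d s0 0 p.
Definition flat_rad b := radii (ball_type mults t b).

Lemma radiiE (i : 'I_t) : radii i = brad i.
Proof.
by rewrite /radii /= (nth_map i) ?size_enum_ord // nth_ord_enum.
Qed.

Lemma multsE (i : 'I_t) : mults i = mlt i.
Proof.
by rewrite /mults /= (nth_map i) ?size_enum_ord // nth_ord_enum.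
Qed.

Lemma pointsE (p : 'I_n) : points p = pts p.
Proof.
apply/rowP => l; rewrite mxE /= -[X in (p * X)%N](size_enum_ord d).
by rewrite (nth_allpairs p l) ?size_enum_ord // !nth_ord_enum.
Qed.

Lemma offsetE (i : nat) : (i <= t)%N ->
  offset mults i = (\sum_(i' < t | (i' < i)%N) mlt i')%N.
Proof.
move=> it; rewrite /offset big_mkord (big_ord_widen t (fun i => mults i) it).
by apply: eq_bigr => j _; rewrite multsE.
Qed.

Lemma offset_total : offset mults t = k.
Proof.
by rewrite offsetE //; apply: eq_bigl => i; rewrite ltn_ord.
Qed.

Lemma ball_exists b : (b < k)%N -> exists (i : 'I_t) (j : 'I_(mlt i)),
  b = (offset mults i + j)%N.
Proof.
rewrite -offset_total => /ball_typeP[h1 h2 h3].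
have jl : (b - offset mults (ball_type mults t b) < mlt (Ordinal h1))%N.
  by rewrite -multsE /= ltn_subLR.
by exists (Ordinal h1), (Ordinal jl); rewrite /= subnKC.
Qed.

Lemma ball_lt (i : 'I_t) (j : 'I_(mlt i)) : (offset mults i + j < k)%N.
Proof.
rewrite -offset_total; apply: leq_trans (leq_offset mults (ltn_ord i)).
by rewrite offsetS ltn_add2l multsE.
Qed.

Lemma ball_type_ord (i : 'I_t) (j : 'I_(mlt i)) :
  ball_type mults t (offset mults i + j) = i.
Proof. by apply: ball_typeE; rewrite ?multsE. Qed.

Lemma flat_radE (i : 'I_t) (j : 'I_(mlt i)) :
  flat_rad (offset mults i + j) = brad i.
Proof. by rewrite /flat_rad ball_type_ord radiiE. Qed.

Lemma flat_rad_gt0 b : (b < k)%N -> (0 < flat_rad b)%N.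
Proof. by move=> /ball_exists[i [j ->]]; rewrite flat_radE brad_gt0. Qed.

Lemma out_centersE s (i : 'I_t) (j : 'I_(mlt i)) :
  out_centers I s i j = vec d s 2 (offset mults i + j).
Proof.
by apply/rowP => l; rewrite !mxE offsetE // ltnW.
Qed.

Lemma recorded_feasible s : recorded n k points flat_rad s ->
  feasible (out_dilation s) (out_centers I s).
Proof.
move=> [r0 cov]; split=> // p; have [b bk Hb] := cov p (ltn_ord p).
have [i [j bE]] := ball_exists bk; exists i, j.
rewrite out_centersE -bE -pointsE -(flat_radE j) -bE.
rewrite -(@ler_pXn2r _ 2) ?nnegrE ?sqrtr_ge0 ?mulr_ge0 //.
by rewrite sqr_sqrtr ?sqd_ge0.
Qed.

Lemma flatten_feasible alpha (c : centers I) : feasible alpha c ->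
  exists (cs : nat -> 'rV[R]_d) (sg : nat -> nat), forall p, (p < n)%N ->
    (sg p < k)%N /\
    sqd (points p) (cs (sg p)) <= (alpha * (flat_rad (sg p))%:R) ^+ 2.
Proof.
move=> [a0 cov].
(* Quantifying over all pairs with number [b] avoids transporting [j] between the types
   ['I_(mlt i)]. *)
have /choice[cs csE] : forall b, exists y, forall (i : 'I_t) (j : 'I_(mlt i)),
    b = (offset mults i + j)%N -> y = c i j.
  move=> b; case: (ltnP b k) => [/ball_exists[i [j bE]]|kb]; last first.
    by exists 0 => i j bE; move: kb; rewrite bE leqNgt ball_lt.
  exists (c i j) => i' j' bE'.
  have ii : i' = i.
    by apply: val_inj; rewrite /= -(ball_type_ord j') -(ball_type_ord j) -bE -bE'.
  move: j' bE'; rewrite ii => j'; rewrite bE => /addnI jj.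
  by congr (c i _); apply: val_inj.
have /choice[sg sgE] : forall p, exists b, (p < n)%N -> (b < k)%N /\
    sqd (points p) (cs b) <= (alpha * (flat_rad b)%:R) ^+ 2.
  move=> p; case: (ltnP p n) => pn; last by exists 0%N.
  have [i [j H]] := cov (Ordinal pn).
  exists (offset mults i + j)%N => _; split; first exact: ball_lt.
  rewrite flat_radE (csE _ i j) // -[p]/(val (Ordinal pn)) pointsE.
  have := sqd_ge0 (pts (Ordinal pn)) (c i j) => h.
  rewrite -[leLHS]sqr_sqrtr // ler_pXn2r ?nnegrE ?sqrtr_ge0 ?mulr_ge0 //.
by exists cs, sg.
Qed.

Definition total_time M :=
  (k * (k * 60 + 60) + k * M * 60 + 100 +
   (k ^ (k * M) * (k * M * (step_time d n k (M * M) (k * M) + 20) +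
      k * M * 60 + 100) + 20))%N.

Lemma wp_prog M : wp (nukc_prog M) s0 (total_time M) (fun s =>
  ((0 < imem s 9 0)%N -> recorded n k points flat_rad s) /\
  forall v j, (v < k ^ (k * M))%N -> (j < k * M)%N ->
    best_le (dil points n k (M * M) flat_rad
      (hist points n k (M * M) flat_rad (digit k v) j)) s).
Proof.
have n0 := npts_gt0 I; have k0 : (0 < k)%N := mlt_sum_gt0 I.
have := @wp_setup R t M radii mults s0 erefl erefl
  (fun i _ => erefl) (fun i _ => erefl).
rewrite offset_total => /(_ (ntypes_le I)) setup.
apply: (wp_seq setup) => s1 [K kE LE KE rE].
apply: (@wp_search R d n k (M * M) points flat_rad n0 k0 flat_rad_gt0) => //.
- split=> //; try by rewrite (keepsI K 0 isT).
  by move=> p; rewrite (vec_keeps K).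
- by move=> h _; rewrite (keepsI K 7 isT) /= nth_nil.
- by rewrite (keepsI K 9 isT).
Qed.

Lemma best_approx (e : R) M s : 0 < e -> e <= 1 -> 16 <= M%:R * e ->
  ((0 < imem s 9 0)%N -> recorded n k points flat_rad s) ->
  (forall v j, (v < k ^ (k * M))%N -> (j < k * M)%N ->
    best_le (dil points n k (M * M) flat_rad
      (hist points n k (M * M) flat_rad (digit k v) j)) s) ->
  approx_solution e (out_dilation s) (out_centers I s).
Proof.
move=> e0 e1 Me rec best.
have n0 := npts_gt0 I; have k0 : (0 < k)%N := mlt_sum_gt0 I.
have M0 : (0 < M)%N.
  by rewrite lt0n; apply: contraTneq Me => ->; rewrite mul0r -ltNge.
have feas : feasible (out_dilation s) (out_centers I s).
  apply/recorded_feasible/rec.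
  have [] // := best 0%N 0%N; first by rewrite expn_gt0 k0.
  by rewrite muln_gt0 k0.
have ep : 0 < 1 + e by rewrite addr_gt0.
have key alpha : (exists c : centers I, feasible alpha c) ->
    out_dilation s <= (1 + e) * alpha.
  move=> [c fc]; apply/ler_addgt0Pr => x x0.
  have a0 : 0 <= alpha by case: fc.
  (* The progress argument needs a positive dilation, but [alpha] may be 0. The increase costs
     exactly [x] after multiplication by 1 + e, and [x] is arbitrary. As every feasible [alpha] is
     treated, attainment of the infimum is never an issue. *)
  pose a := alpha + x / (1 + e).
  have ap : 0 < a by rewrite ltr_wpDl // divr_gt0.
  have fa : feasible a c.
    case: fc => _ cov; split=> [|p]; first exact: ltW.
    have [i [j H]] := cov p; exists i, j; apply: le_trans H _.
    by rewrite ler_wpM2r // lerDl divr_ge0 // ltW.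
  have [cs [sg sgP]] := flatten_feasible fa.
  have [w [wk [j jL Hj]]] := exists_good_history n0 k0 flat_rad_gt0 e0 e1 ap Me
    (fun p pn => (sgP p pn).1) (fun p pn => (sgP p pn).2).
  have [v vK vE] := digit_exists (k * M) k0 wk.
  have [_] := best v j vK jL.
  rewrite (hist_ext _ _ _ _ _ (ltnW jL) vE) => h.
  apply: le_trans h _; apply: le_trans Hj _.
  by rewrite /a mulrDr lerD2l mulrC divfK // gt_eqF.
split=> //; rewrite mulrC -ler_pdivrMr //; apply: lb_le_inf.
  by exists (out_dilation s); exists (out_centers I s).
by move=> a /key; rewrite ler_pdivrMr // mulrC.
Qed.

Lemma total_time_le M : (0 < M)%N ->
  (total_time M <= 2 ^ (11 + 4 * (k * M)) * k ^ (k * M) * d * n)%N.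
Proof.
move=> M0; have n0 := npts_gt0 I; have d0 := ndim_gt0 I.
have k0 : (0 < k)%N := mlt_sum_gt0 I.
rewrite /total_time.
move: (nballs I) (npts I) (ndim I) k0 n0 d0 => k n d k0 n0 d0.
have [q qE] : {q | q = (k * M)%N} by exists (k * M)%N.
rewrite -qE; set W := (k ^ q)%N.
have W0 : (0 < W)%N by rewrite expn_gt0 k0.
have q0 : (0 < q)%N by rewrite qE muln_gt0 k0.
have kq : (k <= q)%N by rewrite qE leq_pmulr.
have Mq : (M <= q)%N by rewrite qE leq_pmull.
(* [Y] dominates one step: computing k centers takes k M^2 iterations over at most q points, and k
   M^2 q = q M q <= q^3. *)
pose Y := (q * q * q * d * n)%N.
have qd : (d <= q * d)%N by rewrite leq_pmull.
have Y1 : (k * (M * M * (q * d)) <= Y)%N.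
  apply: (@leq_trans (q * q * q * d)); last by rewrite leq_pmulr.
  have -> : (k * (M * M * (q * d)) = q * (M * (q * d)))%N by rewrite !mulnA -qE.
  by rewrite -!mulnA; do 2 apply: leq_mul => //.
have MMqd : (q * d <= M * M * (q * d))%N by rewrite leq_pmull // muln_gt0 M0.
have h1 : (M * M * (q * (d * 60 + 120) + d * 70 + 140) + d * 50 + 100 <=
           540 * (M * M * (q * d)))%N.
  have i1 : (q * (d * 60 + 120) + d * 70 + 140 <= 390 * (q * d))%N.
    have : (q <= q * d)%N by rewrite leq_pmulr.
    by lia.
  have : (M * M * (q * (d * 60 + 120) + d * 70 + 140) <= M * M * (390 * (q * d)))%N.
    by rewrite leq_mul2l i1 orbT.
  lia.
have h2 : (k * (M * M * (q * (d * 60 + 120) + d * 70 + 140) + d * 50 + 100) <=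
           540 * Y)%N.
  apply: leq_trans (_ : k * (540 * (M * M * (q * d))) <= _)%N.
    by rewrite leq_mul2l h1 orbT.
  by rewrite mulnCA leq_mul2l Y1.
have qqq : (k <= q * q * q)%N.
  by apply: (leq_trans kq); rewrite -mulnA leq_pmulr // muln_gt0 q0.
have Y2 : (k * d * n <= Y)%N by rewrite /Y !leq_mul2r qqq !orbT.
have Y3 : (k * d <= k * d * n)%N by rewrite leq_pmulr.
have Y4 : (1 <= k * d)%N by rewrite muln_gt0 k0.
have h3 : (n * (k * (d * 60 + 150) + 80) <= 290 * (k * d * n))%N.
  have kd : (k <= k * d)%N by rewrite leq_pmulr.
  have : (k * (d * 60 + 150) + 80 <= 290 * (k * d))%N by lia.
  by move=> i; rewrite mulnC mulnA leq_mul2r i orbT.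
set step := step_time _ _ _ _ _.
have hstep : (step <= 1060 * Y)%N by rewrite /step /step_time; lia.
have qY : (q <= Y)%N.
  by rewrite /Y -!mulnA leq_pmulr // !muln_gt0 q0 d0.
have h4 : (q * (step + 20) + q * 60 + 100 <= 1240 * (q * Y))%N.
  have : (q * (step + 20) <= q * (1080 * Y))%N.
    by rewrite leq_mul2l; apply/orP; right; lia.
  have : (Y <= q * Y)%N by rewrite leq_pmull.
  lia.
have h5 : (W * (q * (step + 20) + q * 60 + 100) <= 1240 * (W * (q * Y)))%N.
  by rewrite (mulnCA 1240%N) leq_mul2l h4 orbT.
have h6 : (q * Y <= W * (q * Y))%N by rewrite leq_pmull.
have h7 : (k * (k * 60 + 60) + q * 60 + 100 <= 280 * (q * Y))%N.
  have : (k * k <= q * q)%N by rewrite leq_mul.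
  have : (k <= k * k)%N by rewrite leq_pmulr.
  have : (q * q <= q * Y)%N by rewrite leq_mul2l qY orbT.
  have : (q <= q * q)%N by rewrite leq_pmulr.
  lia.
(* The constants 1240, 280 and 20 collected so far add up to less than 2048. *)
apply: (@leq_trans (2 ^ 11 * (W * (q * Y)))).
  by have -> : (2 ^ 11 = 2048)%N by []; lia.
have q2 : (q ^ 4 <= 2 ^ (4 * q))%N.
  by rewrite mulnC expnM leq_exp2r // ltnW // ltn_expl.
have -> : (W * (q * Y) = q ^ 4 * W * d * n)%N.
  by rewrite /Y !expnS expn0; lia.
rewrite expnD; move: (2 ^ 11)%N (q ^ 4)%N (2 ^ (4 * q))%N q2 => a x y xy.
by rewrite -!mulnA; do 2 apply: leq_mul => //.
Qed.

End Instance.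

Lemma powR2_log2 (R : realType) (m : nat) : (0 < m)%N ->
  2 `^ (log2 (m%:R : R)) = m%:R.
Proof.
move=> m0; rewrite /log2 /powR ifF ?pnatr_eq0 //.
have l2 : ln (2 : R) != 0 by rewrite gt_eqF // ln_gt0 // ltr1n.
by rewrite divfK // lnK // posrE ltr0n.
Qed.

(** With m = max 1 (log2 k), the exponent 11 + 4 k M + k M log2 k is at most (11 + 4 + 1) k M m, and
    M <= 17 / min 1 eps; so 272 = 16 * 17. *)
Lemma time_bound_ge (R : realType) (eps : R) k d n M : 0 < eps -> (0 < k)%N ->
  (0 < M)%N -> M%:R * Num.min 1 eps <= 17 ->
  (2 ^ (11 + 4 * (k * M)) * k ^ (k * M) * d * n)%:R <= time_bound 272 eps k d n.
Proof.
move=> eps0 k0 M0 Me; rewrite /time_bound 3!natrM; do 2 apply: ler_wpM2r => //.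
rewrite !natrX -powR_mulrn // -[X in _ * X ^+ _](powR2_log2 R k0).
rewrite -powR_mulrn ?powR_ge0 // -powRrM -powRD; last by rewrite pnatr_eq0 implybT.
apply: ler_powR; first by rewrite ler1n.
set e := Num.min 1 eps in Me *; set l := log2 _.
set m := Num.max 1 l.
have e0 : 0 < e by rewrite lt_min ltr01.
have m1 : 1 <= m by rewrite le_max lexx.
have lm : l <= m by rewrite le_max lexx orbT.
rewrite natrD 2!natrM.
set K : R := k%:R; set q : R := M%:R in Me *.
have K1 : 1 <= K by rewrite ler1n.
have q1 : 1 <= q by rewrite ler1n.
have Kq1 : 1 <= K * q by rewrite mulr_ege1.
apply: (@le_trans _ _ (16 * (K * q * m))).
  have Kqm : K * q <= K * q * m by rewrite ler_peMr // (le_trans ler01).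
  have lKq : l * (K * q) <= K * q * m.
    by rewrite mulrC ler_wpM2l // (le_trans ler01).
  lra.
have -> : 272 * (K * m / e) = 16 * (17 / e * (K * m)) by ring.
rewrite ler_pM2l //.
have -> : K * q * m = q * (K * m) by ring.
apply: ler_wpM2r; first by rewrite mulr_ge0 // (le_trans ler01).
by rewrite ler_pdivlMr.
Qed.

Theorem theorem12 (R : realType) :
  exists C : R, 0 < C /\
    forall eps : R, 0 < eps ->
      exists prog : cmd,
        forall I : nukc R,
          exists (T : nat) (s : state R),
            [/\ exec prog (init_state I) T s,
                approx_solution eps (out_dilation s) (out_centers I s)
              & T%:R <= time_bound C eps (nballs I) (ndim I) (npts I)].
Proof.
exists 272; split; first by rewrite ltr0n.
move=> eps eps0; pose e := Num.min 1 eps.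
have e0 : 0 < e by rewrite lt_min ltr01.
have e1 : e <= 1 by rewrite ge_min lexx.
have ee : e <= eps by rewrite ge_min lexx orbT.
(* Rounding up gives 16 <= M e <= 16 + e <= 17: the lower bound is for correctness, the upper one
   for the time. *)
pose M := (Num.truncn (16 / e)).+1.
have M16 : 16 <= M%:R * e by rewrite -ler_pdivrMr // ltW // truncnS_gt.
have M17 : M%:R * e <= 17.
  have /andP[+ _] := truncn_itv (divr_ge0 (ler0n R 16) (ltW e0)).
  by rewrite ler_pdivlMr // /M -natr1 mulrDl mul1r; lra.
exists (nukc_prog M) => I.
have [T [s [ex Tle [rec best]]]] := wp_prog I M.
exists T, s; split=> //.
  have [feas app] := best_approx e0 e1 M16 rec best; split=> //.
  (* Passing from [e] to [eps] uses that the optimal dilation is nonnegative. *)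
  apply: le_trans app _; apply: ler_wpM2r; last by rewrite lerD2l.
  apply: lb_le_inf; first by exists (out_dilation s); exists (out_centers I s).
  by move=> a [c []].
apply: le_trans (time_bound_ge _ _ eps0 (mlt_sum_gt0 I) (ltn0Sn _) M17).
by rewrite ler_nat; apply: leq_trans Tle (total_time_le _ _).
Qed.
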